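(* Fix $\vartheta>0$. For each $i\in\{1,2\}$ the sequence of random variables $(X^{(i)}_{n,\vartheta n}/n)_{n\in\mathbb{N}}$ satisfies the large deviations principle on $\mathbb{R}$ with speed $n$ and rate function $$ I_i(t;\vartheta)=\begin{cases} t\log\mu_i^{\leftarrow}(t)-L_i(\mu_i^{\leftarrow}(t))-(t\log\vartheta-L_i(\vartheta)),& t\in(0,1),\\ L_1(\vartheta),& t=0,\ i=1,\\ +\infty,& t=0,\ i=2,\\ L_i(\vartheta)-1-\log\vartheta,& t=1,\ i\in\{1,2\},\\ +\infty,& t\in\mathbb{R}\setminus[0,1], \end{cases} $$ where, for $t\in(0,1)$, $$\mu_1^{\leftarrow}(t)=-\frac{t}{t+W_{-1}(-te^{-t})},\qquad \mu_2^{\leftarrow}(t)=\frac{t}{1+tW_0(-t^{-1}e^{-1/t})}-t.$$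
   Context: $\genfrac{[}{]}{0pt}{}{n}{k}$ and $\genfrac{\{}{\}}{0pt}{}{n}{k}$ are the (unsigned) Stirling numbers of the first and second kind; $S_n(x)=\sum_{k=1}^n\genfrac{[}{]}{0pt}{}{n}{k}x^k=x(x+1)\cdots(x+n-1)$; $T_n(x)=\sum_{k=1}^n\genfrac{\{}{\}}{0pt}{}{n}{k}x^k$. For $\theta>0$ the random variables $X^{(1)}_{n,\theta}$, $X^{(2)}_{n,\theta}$ take values $k\in\{1,\dots,n\}$ with $\mathbb{P}[X^{(1)}_{n,\theta}=k]=\genfrac{[}{]}{0pt}{}{n}{k}\theta^k/S_n(\theta)$ and $\mathbb{P}[X^{(2)}_{n,\theta}=k]=\genfrac{\{}{\}}{0pt}{}{n}{k}\theta^k/T_n(\theta)$. $W_0$ and $W_{-1}$ are real branches of the Lambert function: $W_0:(-1/e,\infty)\to(-1,\infty)$ is the inverse of $w\mapsto we^w$ on $(-1,\infty)$, and for $z\in(-1/e,0)$, $W_{-1}(z)$ is the unique $w\in(-\infty,-1)$ with $we^w=z$. For $x>0$: $L_1(x)=(x+1)\log(x+1)-x\log x$ and $L_2(x)=W_0(1/x)+\frac{1}{W_0(1/x)}-x+\log x$. (The functions $\mu_i^{\leftarrow}$ are the inverses of $\mu_1(\vartheta)=\vartheta\log(1+1/\vartheta)$ and $\mu_2(\vartheta)=1/W_0(1/\vartheta)-\vartheta$, which are increasing bijections from $(0,\infty)$ to $(0,1)$.) *)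

(* Defs.v *)
From HB Require Import structures.
From mathcomp Require Import all_boot all_order all_algebra.
From mathcomp Require Import all_classical all_reals all_analysis.

Set Implicit Arguments.
Unset Strict Implicit.
Unset Printing Implicit Defensive.

Import Order.TTheory GRing.Theory Num.Theory.
Import numFieldNormedType.Exports.

Local Open Scope classical_set_scope.
Local Open Scope ring_scope.

Inductive kind := First | Second.

Fixpoint stirling1 (n k : nat) : nat :=
  match n, k with
  | 0, 0 => 1
  | 0, _.+1 => 0
  | _.+1, 0 => 0
  | m.+1, j.+1 => (m * stirling1 m j.+1 + stirling1 m j)%N
  end.

Fixpoint stirling2 (n k : nat) : nat :=
  match n, k with
  | 0, 0 => 1
  | 0, _.+1 => 0
  | _.+1, 0 => 0
  | m.+1, j.+1 => (j.+1 * stirling2 m j.+1 + stirling2 m j)%N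
  end.

Definition stirling (i : kind) : nat -> nat -> nat :=
  match i with First => stirling1 | Second => stirling2 end.

Section stirling_large_deviations.
Context {R : realType}.

(* [S_n(x)] for [i = First] and [T_n(x)] for [i = Second]. *)
Definition stirling_poly (i : kind) (n : nat) (x : R) : R :=
  \sum_(1 <= k < n.+1) (stirling i n k)%:R * x ^+ k.

(* The weights below sum to 1 over [1 <= k <= n], so that [X] takes its values
   in {1, ..., n} almost surely. *)
Definition stirling_distributed (i : kind) (n : nat) (theta : R)
    d (T : measurableType d) (P : probability T R) (X : {RV P >-> R}) : Prop :=
  forall k : nat, (1 <= k <= n)%N ->
    P [set w | X w = k%:R] =
      ((stirling i n k)%:R * theta ^+ k / stirling_poly i n theta)%:E.

(* The two real branches of the Lambert function; the value outside of the
   domain of a branch (e.g. for [z <= - expR (-1)]) is irrelevant. *)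
Definition lambertW0 : R -> R :=
  'pinv_(fun=> 0) [set w | -1 < w] (fun w => w * expR w).

Definition lambertWm1 : R -> R :=
  'pinv_(fun=> 0) [set w | w < -1] (fun w => w * expR w).

Definition logL (i : kind) (x : R) : R :=
  match i with
  | First => (x + 1) * ln (x + 1) - x * ln x
  | Second => lambertW0 x^-1 + (lambertW0 x^-1)^-1 - x + ln x
  end.

Definition mu (i : kind) (x : R) : R :=
  match i with
  | First => x * ln (1 + x^-1)
  | Second => (lambertW0 x^-1)^-1 - x
  end.

Definition mu_inv (i : kind) : R -> R :=
  'pinv_(fun=> 0) [set x | 0 < x] (mu i).

Definition stirling_rate (i : kind) (vartheta t : R) : \bar R :=
  if 0 < t < 1 then
    (t * ln (mu_inv i t) - logL i (mu_inv i t)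
     - (t * ln vartheta - logL i vartheta))%:E
  else if t == 0 then
    match i with First => (logL First vartheta)%:E | Second => +oo%E end
  else if t == 1 then (logL i vartheta - 1 - ln vartheta)%:E
  else +oo%E.

Definition large_deviations_principle (speed : nat -> R)
    (d : nat -> measure_display) (T : forall n, measurableType (d n))
    (P : forall n, probability (T n) R) (Y : forall n, T n -> R)
    (I : R -> \bar R) : Prop :=
  [/\ forall x, (0 <= I x)%E,
      lower_semicontinuous I,
      forall F : set R, closed F ->
        (limn_esup (fun n => (speed n)^-1%:E * lne (P n (Y n @^-1` F)))
          <= - ereal_inf (I @` F))%E
    & forall G : set R, open G ->
        (- ereal_inf (I @` G)
          <= limn_einf (fun n => (speed n)^-1%:E * lne (P n (Y n @^-1` G))))%E].

End stirling_large_deviations.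

(* Main.v *)
(* Write Z_n(x) for S_n(xn) or T_n(xn).  Then ln Z_n(x) / n - ln n tends to
   L(x) - 1: for S_n this is a Riemann sum of ln over [x, x + 1]; for T_n it
   comes from Dobinski's formula, bounding T_n from below by one well-chosen term
   m^n X^m / m! of exp(X) T_n(X) and from above through m^n <= n! z^-n exp(z m).
   Since mu(x) is the derivative of L with respect to ln x and is increasing, L is
   strictly convex in ln x, with tangent slope mu(x); the rate function is thus
   the Legendre transform sup_x (t ln x - L(x)) - (t ln vartheta - L(vartheta)).
   Replacing vartheta by x tilts the law of X_n by the factor (x/vartheta)^X_n,
   so that Chernoff bounds at the points of a closed set closest to mu(vartheta)
   give the upper bound, and concentration at t of the law of parameter
   mu_inv(t) gives the lower bound at every t in (0, 1).  The endpoints 0 and 1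
   are reduced to interior points by convexity of the rate function. *)

Require Import Defs.
From HB Require Import structures.
From mathcomp Require Import all_boot all_order all_algebra.
From mathcomp Require Import all_classical all_reals all_analysis.
From mathcomp Require Import ring lra.
Import Order.TTheory GRing.Theory Num.Theory.
Import numFieldNormedType.Exports.
Local Open Scope classical_set_scope.
Local Open Scope ring_scope.

Set Implicit Arguments.
Unset Strict Implicit.
Unset Printing Implicit Defensive.

(** * Derivatives and the Lambert function *)

Lemma MVT_gt0 (R : realType) (f df : R -> R) (a b : R) :
  0 < a -> a < b -> (forall x : R, 0 < x -> is_derive x 1 f (df x)) ->
  exists2 c, a < c < b & f b - f a = df c * (b - a).
Proof.
move=> a0 ab fdf; have [||c] := @MVT R f df a b ab.
- by move=> x; rewrite in_itv => /andP[ax _]; apply: fdf; exact: lt_trans ax.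
- apply: derivable_within_continuous => x; rewrite in_itv => /andP[ax _].
  by have [] := fdf x (lt_le_trans a0 ax).
- by rewrite in_itv /=; exists c.
Qed.

Lemma lt_of_derive_gt0 (R : realType) (f df : R -> R) (a b : R) :
  0 < a -> a < b -> (forall x : R, 0 < x -> is_derive x 1 f (df x)) ->
  (forall x, a < x < b -> 0 < df x) -> f a < f b.
Proof.
move=> a0 ab fdf df0; have [c acb e] := MVT_gt0 a0 ab fdf.
by rewrite -subr_gt0 e mulr_gt0 ?df0 ?subr_gt0.
Qed.

Lemma gt_of_derive_lt0 (R : realType) (f df : R -> R) (a b : R) :
  0 < a -> a < b -> (forall x : R, 0 < x -> is_derive x 1 f (df x)) ->
  (forall x, a < x < b -> df x < 0) -> f b < f a.
Proof.
move=> a0 ab fdf df0; have [c acb e] := MVT_gt0 a0 ab fdf.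
by rewrite -subr_lt0 e nmulr_rlt0 ?df0 ?subr_gt0.
Qed.

(* The library states these for [f + g], [f * g], and so on, which does not
   unify with an explicit lambda-abstraction. *)
Lemma is_derive1_eq (R : realType) (f : R -> R) (x a b : R) :
  is_derive x 1 f a -> a = b -> is_derive x 1 f b.
Proof. by move=> ? <-. Qed.

Lemma is_derive1D (R : realType) (f g : R -> R) (x a b : R) :
  is_derive x 1 f a -> is_derive x 1 g b ->
  is_derive x 1 (fun y => f y + g y) (a + b).
Proof. by move=> ? ?; exact: is_deriveD. Qed.

Lemma is_derive1_cst (R : realType) (k x : R) : is_derive x 1 (fun=> k) 0.
Proof. exact: is_derive_cst. Qed.

Lemma is_derive1M (R : realType) (f g : R -> R) (x a b : R) :
  is_derive x 1 f a -> is_derive x 1 g b ->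
  is_derive x 1 (fun y => f y * g y) (f x * b + g x * a).
Proof. by move=> ? ?; exact: is_deriveM. Qed.
Lemma is_derive1B (R : realType) (f g : R -> R) (x a b : R) :
  is_derive x 1 f a -> is_derive x 1 g b ->
  is_derive x 1 (fun y => f y - g y) (a - b).
Proof. by move=> ? ?; exact: is_deriveB. Qed.

Lemma is_derive1_ln_succ (R : realType) (x : R) : 0 < x + 1 ->
  is_derive x 1 (fun y : R => ln (y + 1)) (x + 1)^-1.
Proof.
move=> h.
have h2 : is_derive (x+1) 1 (@ln R) (x+1)^-1 by apply: is_derive1_ln; lra.
have h3 : is_derive x 1 (fun y : R => y + 1) 1.
  by apply: is_derive_eq; rewrite addr0.
have := @is_derive1_comp R (@ln R) (fun y : R => y + 1) x _ _ h2 h3.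
by rewrite mulr1.
Qed.
Lemma is_derive1_inv (R : realType) (x : R) :
  0 < x -> is_derive x 1 (fun y : R => y^-1) (- x ^- 2).
Proof.
move=> h; have := @is_deriveV R id x 1 1 (lt0r_neq0 h) (is_derive_id _ _).
by rewrite /GRing.scale /= mulr1.
Qed.

Lemma is_derive1_expRN (R : realType) (x : R) :
  is_derive x 1 (fun y : R => expR (- y)) (- expR (- x)).
Proof.
have h3 : is_derive x 1 (fun y : R => - y) (-1) by exact: is_deriveNid.
have := @is_derive1_comp R (@expR R) (fun y : R => - y) x _ _
  (is_derive_expR _) h3.
by rewrite mulrN1.
Qed.

(** For [b < 0], the bound [1 + (a - b) <= expR (a - b)] reduces the claim to
    [(a - b) * (1 + a) < 0]. [mulexp_decr] is the same computation with the roles of [a] and [b]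
    exchanged. *)
Lemma mulexp_incr (R : realType) (a b : R) :
  -1 < a -> a < b -> a * expR a < b * expR b.
Proof.
move=> a1 ab; have [b0|b0] := leP 0 b.
  apply: (@lt_le_trans _ _ (b * expR a)); first by rewrite ltr_pM2r ?expR_gt0.
  by rewrite ler_wpM2l // ler_expR ltW.
have h := expR_ge1Dx (a - b).
have e0 := expR_gt0 b.
have -> : expR a = expR (a - b) * expR b by rewrite -expRD subrK.
rewrite mulrA ltr_pM2r //.
have : a * expR (a - b) <= a * (1 + (a - b)) by rewrite ler_wnM2l //; lra.
nra.
Qed.

Lemma mulexp_decr (R : realType) (a b : R) :
  b < -1 -> a < b -> b * expR b < a * expR a.
Proof.
move=> b1 ab.
have h := expR_ge1Dx (b - a).
have e0 := expR_gt0 a.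
have -> : expR b = expR (b - a) * expR a by rewrite -expRD subrK.
rewrite mulrA ltr_pM2r //.
have : b * expR (b - a) <= b * (1 + (b - a)) by rewrite ler_wnM2l //; lra.
nra.
Qed.

Lemma continuous_mulexp (R : realType) : continuous (fun w : R => w * expR w).
Proof. by move=> x; apply: continuousM => //; exact: continuous_expR. Qed.

Lemma lambertW0K (R : realType) (w : R) : -1 < w -> lambertW0 (w * expR w) = w.
Proof.
move=> w1; rewrite /lambertW0.
rewrite (@pinvKV _ _ _ [set w | -1 < w] (fun w => w * expR w)) ?inE //.
move=> a b; rewrite !inE /= => a1 b1 /eqP; apply: contraTeq.
by case: ltgtP => // ab _; rewrite ?(lt_eqF (mulexp_incr _ ab))
  ?(gt_eqF (mulexp_incr _ ab)).
Qed.

Lemma lambertWm1K (R : realType) (w : R) : w < -1 -> lambertWm1 (w * expR w) = w.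
Proof.
move=> w1; rewrite /lambertWm1.
rewrite (@pinvKV _ _ _ [set w | w < -1] (fun w => w * expR w)) ?inE //.
move=> a b; rewrite !inE /= => a1 b1 /eqP; apply: contraTeq.
by case: ltgtP => // ab _; rewrite ?(lt_eqF (mulexp_decr _ ab))
  ?(gt_eqF (mulexp_decr _ ab)).
Qed.

(* [x = expR (- w) / w] is the substitution [w = W_0(1/x)], which makes every
   function of the second kind elementary. *)
Definition lambert_param (R : realType) (w : R) : R := expR (- w) / w.

Lemma lambert_param_gt0 (R : realType) (w : R) : 0 < w -> 0 < lambert_param w.
Proof. by move=> w0; rewrite divr_gt0 ?expR_gt0. Qed.

Lemma lambertW0_param (R : realType) (w : R) : 0 < w ->
  lambertW0 (lambert_param w)^-1 = w.
Proof.
move=> w0; rewrite /lambert_param invfM invrK -expRN opprK mulrC lambertW0K //.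
by lra.
Qed.

Lemma mulexp_surj (R : realType) (a b v : R) : a <= b ->
  Num.min (a * expR a) (b * expR b) <= v <= Num.max (a * expR a) (b * expR b) ->
  exists2 w, a <= w <= b & w * expR w = v.
Proof.
move=> ab vab; have [||//|w] := @IVT R (fun w => w * expR w) a b v.
- exact: ab.
- exact/continuous_subspaceT/continuous_mulexp.
by rewrite in_itv /=; exists w.
Qed.

Lemma lambert_param_surj (R : realType) (x : R) : 0 < x ->
  exists2 w, 0 < w & lambert_param w = x.
Proof.
move=> x0; have ix0 : 0 < x^-1 by rewrite invr_gt0.
have [||w /andP[w0 _] e] := @mulexp_surj R 0 x^-1 x^-1.
- exact: ltW.
- rewrite mul0r ge_min (ltW ix0) le_max; apply/orP; right.
  by rewrite ler_peMr ?ltW // expR_gt1.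
have {}w0 : 0 < w.
  rewrite lt_neqAle w0 andbT eq_sym; apply/eqP => w00.
  by move: e ix0; rewrite w00 mul0r => <-; rewrite ltxx.
exists w => //; rewrite /lambert_param expRN -invfM mulrC e invrK //.
Qed.

Lemma mu2_param (R : realType) (w : R) : 0 < w ->
  mu Second (lambert_param w) = (1 - expR (- w)) / w.
Proof.
by move=> w0; rewrite /mu lambertW0_param // /lambert_param; field; lra.
Qed.

Lemma ln_lambert_param (R : realType) (w : R) : 0 < w ->
  ln (lambert_param w) = - w - ln w.
Proof.
by move=> w0; rewrite ln_div ?posrE ?expR_gt0 // expRK.
Qed.

Lemma logL2_param (R : realType) (w : R) : 0 < w ->
  logL Second (lambert_param w) = (1 - expR (- w)) / w - ln w.
Proof.
move=> w0; rewrite /logL lambertW0_param // ln_lambert_param // /lambert_param.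
by field; lra.
Qed.

(** * Monotonicity of [mu] and the strict tangent inequality for [logL] *)

Lemma mu1E (R : realType) (x : R) : 0 < x -> mu First x = x * (ln (x + 1) - ln x).
Proof.
move=> x0; rewrite /mu; have -> : 1 + x^-1 = (x + 1) / x by field; lra.
by rewrite ln_div ?posrE //; lra.
Qed.

(** This is [1 + y < expR y] at [y = - (x + 1)^-1]; [ln_succ_lt] is the same inequality at
    [y = x^-1]. *)
Lemma ln_succ_gt (R : realType) (x : R) : 0 < x -> (x + 1)^-1 < ln (x + 1) - ln x.
Proof.
move=> x0; have x10 : 0 < x + 1 by lra.
rewrite -ln_div ?posrE // -[X in X < _]opprK -[X in _ < X]opprK ltrN2.
rewrite -lnV ?posrE ?divr_gt0 // invf_div.
have := @expR_gt1Dx R (- (x + 1)^-1).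
have -> : 1 + - (x + 1)^-1 = x / (x + 1) by field; lra.
move=> h; rewrite -ltr_expR lnK ?posrE ?divr_gt0 //; apply: h.
by rewrite oppr_eq0 invr_eq0; lra.
Qed.

Lemma ln_succ_lt (R : realType) (x : R) : 0 < x -> ln (x + 1) - ln x < x^-1.
Proof.
move=> x0; have x10 : 0 < x + 1 by lra.
rewrite -ln_div ?posrE // -ltr_expR lnK ?posrE ?divr_gt0 //.
have -> : (x + 1) / x = 1 + x^-1 by field; lra.
by rewrite expR_gt1Dx // invr_eq0; lra.
Qed.

Lemma is_derive1_mu1 (R : realType) (x : R) : 0 < x ->
  is_derive x 1 (fun y : R => y * (ln (y + 1) - ln y))
    (x * ((x + 1)^-1 - x^-1) + (ln (x + 1) - ln x)).
Proof.
move=> x0; have x10 : 0 < x + 1 by lra.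
apply: is_derive1_eq.
  exact: is_derive1M (is_derive_id _ _)
    (is_derive1B (is_derive1_ln_succ x10) (is_derive1_ln x0)).
by rewrite mulr1.
Qed.

Lemma mu1_incr (R : realType) (a b : R) : 0 < a -> a < b ->
  mu First a < mu First b.
Proof.
move=> a0 ab; rewrite !mu1E //; last by lra.
apply: (lt_of_derive_gt0 a0 ab (@is_derive1_mu1 R)) => x /andP[ax xb].
have x0 : 0 < x by lra.
have -> : x * ((x + 1)^-1 - x^-1) = - (x + 1)^-1 by field; lra.
by have := ln_succ_gt x0; lra.
Qed.

Lemma logL1E (R : realType) (x : R) : 0 < x ->
  logL First x = x * (ln (x + 1) - ln x) + ln (x + 1).
Proof. by move=> x0; rewrite /logL; ring. Qed.

(** The function [F], which is [logL First z - m * ln z], has derivative [(mu First z - m) / z]. As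
    [mu First] increases, this is negative before [y] and positive after it, so [y] is the strict
    minimum. *)
Lemma logL1_tangent (R : realType) (x y : R) : 0 < x -> 0 < y -> x != y ->
  mu First y * (ln x - ln y) < logL First x - logL First y.
Proof.
move=> x0 y0 xy; set m := mu First y.
pose F z := z * (ln (z + 1) - ln z) + (ln (z + 1) - m * ln z).
have dF (z : R) : 0 < z -> is_derive z 1 F ((mu First z - m) / z).
  move=> z0; have z10 : 0 < z + 1 by lra.
  apply: is_derive1_eq.
    exact: is_derive1D (is_derive1_mu1 z0) (is_derive1B (is_derive1_ln_succ z10)
      (is_derive1M (is_derive1_cst m z) (is_derive1_ln z0))).
  rewrite mu1E // /=; field; lra.
suff : F y < F x by rewrite !logL1E // /F; lra.
have [xy'|yx|e] := ltgtP x y; last by rewrite e eqxx in xy.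
  apply: (gt_of_derive_lt0 x0 xy' dF) => z /andP[xz zy].
  have z0 : 0 < z by lra.
  by rewrite pmulr_llt0 ?invr_gt0 // subr_lt0 mu1_incr.
apply: (lt_of_derive_gt0 y0 yx dF) => z /andP[yz zx].
have z0 : 0 < z by lra.
by rewrite pmulr_lgt0 ?invr_gt0 // subr_gt0 mu1_incr.
Qed.

Lemma is_derive1_mu2 (R : realType) (w : R) : 0 < w ->
  is_derive w 1 (fun y : R => (1 - expR (- y)) / y)
    ((1 - expR (- w)) * - w ^- 2 + w^-1 * expR (- w)).
Proof.
move=> w0; apply: is_derive1_eq.
  exact: is_derive1M (is_derive1B (is_derive1_cst 1 w) (is_derive1_expRN w))
    (is_derive1_inv w0).
by rewrite sub0r opprK.
Qed.

(** The derivative has the sign of [(1 + w) * expR (- w) - 1], negative by [1 + w < expR w]. Since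
    [lambert_param] decreases, decrease in [w] means that [mu Second] increases in [x]. *)
Lemma mu2_decr (R : realType) (a b : R) : 0 < a -> a < b ->
  (1 - expR (- b)) / b < (1 - expR (- a)) / a.
Proof.
move=> a0 ab.
apply: (gt_of_derive_lt0 a0 ab (@is_derive1_mu2 R)) => w /andP[aw wb].
have w0 : 0 < w by lra.
have -> : (1 - expR (- w)) * - w ^- 2 + w^-1 * expR (- w) =
   ((1 + w) * expR (- w) - 1) / w ^+ 2 by field; lra.
rewrite pmulr_llt0 ?invr_gt0 ?exprn_gt0 // expRN subr_lt0.
by rewrite ltr_pdivrMr ?expR_gt0 // mul1r expR_gt1Dx // gt_eqF.
Qed.

(** As for the first kind, but in the variable [w], where [ln x = - w - ln w]: here [F] is
    [logL Second - m * ln] along [lambert_param], and the sign of its derivative is that of [m]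
    minus the slope. *)
Lemma logL2_tangent (R : realType) (x y : R) : 0 < x -> 0 < y -> x != y ->
  mu Second y * (ln x - ln y) < logL Second x - logL Second y.
Proof.
move=> /lambert_param_surj[w w0 <-] /lambert_param_surj[v v0 <-] xy.
have wv : w != v by apply: contraNneq xy => ->.
rewrite !logL2_param // !ln_lambert_param // mu2_param //.
set m := (1 - expR (- v)) / v.
pose F z := (1 - expR (- z)) / z + (m * (z + ln z) - ln z).
have dF (z : R) : 0 < z ->
    is_derive z 1 F ((m - (1 - expR (- z)) / z) * (1 + z^-1)).
  move=> z0; apply: is_derive1_eq.
    exact: is_derive1D (is_derive1_mu2 z0)
      (is_derive1B (is_derive1M (is_derive1_cst m z)
      (is_derive1D (is_derive_id z 1) (is_derive1_ln z0))) (is_derive1_ln z0)).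
  rewrite /=; field; lra.
suff : F v < F w by rewrite /F /m; lra.
have pos (z : R) : 0 < z -> 0 < 1 + z^-1 by move=> z0; rewrite addr_gt0 ?invr_gt0.
have [wv'|vw|e] := ltgtP w v; last by rewrite e eqxx in wv.
  apply: (gt_of_derive_lt0 w0 wv' dF) => z /andP[xz zy].
  have z0 : 0 < z by lra.
  by rewrite pmulr_llt0 ?pos // subr_lt0 mu2_decr.
apply: (lt_of_derive_gt0 v0 vw dF) => z /andP[yz zx].
have z0 : 0 < z by lra.
by rewrite pmulr_lgt0 ?pos // subr_gt0 mu2_decr.
Qed.

Lemma logL_tangent (R : realType) i (x y : R) : 0 < x -> 0 < y -> x != y ->
  mu i y * (ln x - ln y) < logL i x - logL i y.
Proof. by case: i; [exact: logL1_tangent | exact: logL2_tangent]. Qed.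

(** With equal slopes, the strict tangent inequalities at [x] and at [y] add up to [0 < 0]. *)
Lemma mu_inj (R : realType) i : {in [set x : R | 0 < x] &, injective (mu i)}.
Proof.
move=> x y; rewrite !inE /= => x0 y0 e; apply/eqP; apply: contraT => xy.
have h1 := logL_tangent i x0 y0 xy; rewrite eq_sym in xy.
by have := logL_tangent i y0 x0 xy; rewrite e in h1 *; lra.
Qed.

(** * The inverse of [mu] through the Lambert branches *)

Lemma mulexpN_lt (R : realType) (r : R) : r != 1 -> r * expR (- r) < expR (-1).
Proof.
move=> r1; have := @expR_gt1Dx R (r - 1); rewrite subr_eq0 r1 => /(_ isT).
rewrite (addrC 1) subrK => h.
by have -> : expR (-1) = expR (r - 1) * expR (- r) :> R;
  [rewrite -expRD; congr expR; ring | rewrite ltr_pM2r ?expR_gt0].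
Qed.

Lemma lambertWm1_spec (R : realType) (t : R) : 0 < t < 1 ->
  let w := lambertWm1 (- t * expR (- t)) in
  w < -1 /\ w * expR w = - t * expR (- t).
Proof.
move=> /andP[t0 t1]; set v := t * expR (- t).
have v0 : 0 < v by rewrite mulr_gt0 ?expR_gt0.
have vlt : v < expR (-1) by rewrite mulexpN_lt // lt_eqF.
have v1 : v < 1.
  by apply: lt_le_trans vlt _; rewrite expR_le1; lra.
(* The left end [- (2 / v)] of the interval for the intermediate value theorem is far enough,
   because [v * expR (2 / v) >= v * (1 + (2 / v)^2 / 2) = v + 2 / v]. *)
have K2 : 2 < 2 / v by rewrite ltr_pdivlMr //; lra.
rewrite /= mulNr -/v.
have [||w /andP[_ w1] e] := @mulexp_surj R (- (2 / v)) (-1) (- v).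
- lra.
- rewrite ge_min le_max mulN1r lerN2 (ltW vlt) orbT /=.
  rewrite mulNr lerN2; apply/orP; left.
  rewrite expRN ler_pdivrMr ?expR_gt0 //.
  have h : 1 + (2 / v) ^+ 2 / 2`!%:R <= expR (2 / v).
    by apply: expR_ge1Dxn; lra.
  apply: (@le_trans _ _ (v * (1 + (2 / v) ^+ 2 / 2`!%:R))).
    rewrite (_ : 2`!%:R = 2) //.
    have -> : v * (1 + (2 / v) ^+ 2 / 2) = v + 2 / v by field; lra.
    lra.
  by rewrite ler_pM2l.
have {}w1 : w < -1.
  rewrite lt_neqAle w1 andbT; apply: contraTneq vlt => we.
  by move: e; rewrite we mulN1r => /oppr_inj e'; rewrite -leNgt e'.
by rewrite -e lambertWm1K.
Qed.

(** As [- r < -1] is the preimage on the lower branch, [lambertW0] returns the other one. *)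
Lemma lambertW0_spec (R : realType) (r : R) : 1 < r ->
  let w := lambertW0 (- r * expR (- r)) in
  -1 < w < 0 /\ w * expR w = - r * expR (- r).
Proof.
move=> r1; set v := r * expR (- r).
have v0 : 0 < v by rewrite mulr_gt0 ?expR_gt0 //; lra.
have vlt : v < expR (-1) by rewrite mulexpN_lt // gt_eqF.
rewrite /= mulNr -/v.
have [||w /andP[w1 w0] e] := @mulexp_surj R (-1) 0 (- v).
- lra.
- rewrite ge_min le_max mulN1r lerN2 (ltW vlt) /=.
  by rewrite mul0r oppr_le0 (ltW v0) orbT.
have {}w1 : -1 < w.
  rewrite lt_neqAle w1 andbT; apply: contraTneq vlt => we.
  by move: e; rewrite -we mulN1r => /oppr_inj e'; rewrite -leNgt e'.
have {}w0 : w < 0.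
  rewrite lt_neqAle w0 andbT; apply: contraTneq v0 => we.
  by move: e; rewrite we mul0r => e'; rewrite -leNgt; lra.
by rewrite -e lambertW0K // w1 w0.
Qed.

Definition mu_inv_formula (R : realType) (i : kind) (t : R) : R :=
  match i with
  | First => - (t / (t + lambertWm1 (- t * expR (- t))))
  | Second => t / (1 + t * lambertW0 (- t^-1 * expR (- t^-1))) - t
  end.

Lemma mu_formula (R : realType) i (t : R) : 0 < t < 1 ->
  0 < mu_inv_formula i t /\ mu i (mu_inv_formula i t) = t.
Proof.
move=> t01; have /andP[t0 t1] := t01; case: i; rewrite /mu_inv_formula.
  have [] := lambertWm1_spec t01; set w := lambertWm1 _ => w1 e. clearbody w.
  have x0 : 0 < - (t / (t + w)).
    by rewrite -mulrN -invrN divr_gt0 //; lra.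
  split=> //. rewrite mu1E //.
  (* With [x = - (t / (t + w))] the quotient [(x + 1) / x] is [- w / t], so the equation of [w]
     makes the logarithm in [mu First x] equal to [- w - t]. *)
  have wt : - w / t = expR (- w - t).
    rewrite expRD expRN -[in LHS](mulfK (lt0r_neq0 (expR_gt0 w)) w) e.
    by field; rewrite (lt0r_neq0 (expR_gt0 _)) /= lt0r_neq0.
  rewrite -ln_div ?posrE //; last by lra.
  have -> : (- (t / (t + w)) + 1) / - (t / (t + w)) = - w / t.
    by field; lra.
  by rewrite wt expRK; field; lra.
have r1 : 1 < t^-1 by rewrite invf_gt1.
have [] := lambertW0_spec r1; set w := lambertW0 _ => /andP[w1 w0] e.
(* The formula of the second kind is [lambert_param q]: the equation of [w] gives
   [expR (- q) = - w * t], whence [(1 - expR (- q)) / q = t]. *)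
pose q := w + t^-1.
have q0 : 0 < q by rewrite /q; lra.
have tq0 : 0 < 1 + t * w.
  have -> : 1 + t * w = t * q by rewrite /q; field; lra.
  exact: mulr_gt0.
have eq : expR (- q) = - w * t.
  rewrite /q opprD expRD expRN -[in RHS](mulfK (lt0r_neq0 (expR_gt0 w)) w) e.
  by field; rewrite (lt0r_neq0 (expR_gt0 _)) /= lt0r_neq0.
have -> : t / (1 + t * w) - t = lambert_param q.
  by rewrite /lambert_param eq /q; field; lra.
split; first exact: lambert_param_gt0.
by rewrite mu2_param // eq /q; field; lra.
Qed.

Lemma mu_inv_unique (R : realType) i (x : R) : 0 < x -> mu_inv i (mu i x) = x.
Proof.
move=> x0; rewrite /mu_inv (@pinvKV _ _ _ [set x | 0 < x] (mu i)) ?inE //.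
exact: mu_inj.
Qed.

Lemma mu_invE (R : realType) i (t : R) : 0 < t < 1 ->
  mu_inv i t = mu_inv_formula i t.
Proof.
by move=> /(mu_formula i)[x0 e]; rewrite -[in LHS]e mu_inv_unique.
Qed.

Lemma mu_invP (R : realType) i (t : R) : 0 < t < 1 ->
  0 < mu_inv i t /\ mu i (mu_inv i t) = t.
Proof. by move=> t01; rewrite mu_invE //; exact: mu_formula. Qed.

Lemma mu_gt0 (R : realType) i (x : R) : 0 < x -> 0 < mu i x.
Proof.
case: i => x0.
  by rewrite mu1E // mulr_gt0 // (lt_trans _ (ln_succ_gt x0)) // invr_gt0; lra.
have [w w0 <-] := lambert_param_surj x0.
by rewrite mu2_param // divr_gt0 // subr_gt0 expR_lt1; lra.
Qed.

Lemma mu_lt1 (R : realType) i (x : R) : 0 < x -> mu i x < 1.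
Proof.
case: i => x0.
  by rewrite mu1E // mulrC -ltr_pdivlMr // mul1r ln_succ_lt.
have [w w0 <-] := lambert_param_surj x0.
rewrite mu2_param // ltr_pdivrMr // mul1r.
by have := @expR_gt1Dx R (- w); rewrite oppr_eq0 gt_eqF // => /(_ isT); lra.
Qed.

(** * The rate function *)

Lemma logL_tangent_le (R : realType) i (x y : R) : 0 < x -> 0 < y ->
  mu i y * (ln x - ln y) <= logL i x - logL i y.
Proof.
move=> x0 y0; have [->|xy] := eqVneq x y; first by rewrite !subrr mulr0.
exact/ltW/logL_tangent.
Qed.

(** Together with [logL_sub_ln_lt] this identifies the infimum of [logL i x - ln x] as 1, which is
    the source of the value of the rate at [t = 1]. *)
Lemma logL_sub_ln_ge1 (R : realType) i (x : R) : 0 < x -> 1 <= logL i x - ln x.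
Proof.
case: i => x0.
  rewrite logL1E // -addrA -[X in _ + X]mul1r -mulrDl.
  have := ln_succ_gt x0; have x10 : 0 < x + 1 by lra.
  by rewrite -(ltr_pM2l x10) divff ?lt0r_neq0 // => /ltW.
have [w w0 <-] := lambert_param_surj x0.
rewrite logL2_param // ln_lambert_param //.
have h : (1 - expR (- w)) / w >= 1 - w.
  rewrite ler_pdivlMr // -subr_ge0 expRN.
  have := expR_ge1Dx w; have e0 := expR_gt0 w => ew.
  have : (expR w)^-1 <= (1 + w)^-1 by rewrite lef_pV2 ?posrE //; lra.
  have : (1 + w)^-1 <= 1 - w + w ^+ 2.
    rewrite -[X in X <= _]mul1r ler_pdivrMr; last by lra.
    have -> : (1 - w + w ^+ 2) * (1 + w) = 1 + w ^+ 3 by ring.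
    by rewrite lerDl exprn_ge0 // ltW.
  by rewrite expr2; nra.
lra.
Qed.

Lemma logL_sub_ln_lt (R : realType) i (e : R) : 0 < e ->
  exists2 x, 0 < x & logL i x - ln x < 1 + e.
Proof.
case: i => e0.
  exists (2 / e); first by rewrite divr_gt0.
  set x := 2 / e; have x0 : 0 < x by rewrite divr_gt0.
  rewrite logL1E // -addrA -[X in _ + X]mul1r -mulrDl.
  have := ln_succ_lt x0; have x10 : 0 < x + 1 by lra.
  rewrite -(ltr_pM2l x10) => /lt_trans; apply.
  have -> : (x + 1) / x = 1 + e / 2 by rewrite /x; field; lra.
  lra.
exists (lambert_param (e / 2)); first by rewrite lambert_param_gt0 ?divr_gt0.
have w0 : 0 < e / 2 by rewrite divr_gt0.
have := mu_lt1 Second (lambert_param_gt0 w0).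
by rewrite mu2_param // logL2_param // ln_lambert_param //; lra.
Qed.

Lemma logL1_gt0 (R : realType) (x : R) : 0 < x -> 0 < logL First x.
Proof.
move=> x0; rewrite logL1E // addr_gt0 ?ln_gt0 //; last by lra.
by rewrite -mu1E // mu_gt0.
Qed.

(** Serves the rate of the first kind at [t = 0]. The witness is a square because [ln (y^2 + 1) - ln
    (y^2) <= 2 * (ln (y + 1) - ln y) <= 2 / y], so that [logL First] is at most [y^2 + 2 * y]
    there. *)
Lemma logL1_arbitrarily_small (R : realType) (e : R) : 0 < e ->
  exists2 x, 0 < x & logL First x < e.
Proof.
move=> e0; pose y := Num.min 1 (e / 4).
have y0 : 0 < y by rewrite /y lt_min ltr01 divr_gt0.
have y1 : y <= 1 by rewrite /y ge_min lexx.
have ye : y <= e / 4 by rewrite /y ge_min lexx orbT.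
have x0 : 0 < y ^+ 2 by rewrite exprn_gt0.
exists (y ^+ 2) => //; rewrite logL1E //.
have h1 : ln (y ^+ 2 + 1) <= y ^+ 2.
  by rewrite addrC le_ln1Dx //; lra.
have h2 : ln (y ^+ 2 + 1) - ln (y ^+ 2) <= 2 / y.
  have : ln (y + 1) - ln y <= y^-1 by exact/ltW/ln_succ_lt.
  have : ln (y ^+ 2 + 1) <= ln ((y + 1) ^+ 2).
    by rewrite ler_ln ?posrE ?exprn_gt0 //; nra.
  by rewrite !lnXn //; [lra | lra].
have h3 : y ^+ 2 * (ln (y ^+ 2 + 1) - ln (y ^+ 2)) <= y ^+ 2 * (2 / y).
  by rewrite ler_pM2l.
have : y ^+ 2 * (2 / y) = 2 * y by field; lra.
by rewrite expr2 in h1 h2 h3 *; nra.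
Qed.

(** In the parameter [w], [logL Second] is [mu Second] minus [ln w], and [mu Second < 1]. This makes
    the rate of the second kind infinite at [t = 0]. *)
Lemma logL2_unbounded_below (R : realType) (a : R) :
  exists2 x, 0 < x & logL Second x < a.
Proof.
have w0 : 0 < expR (1 - a) by exact: expR_gt0.
exists (lambert_param (expR (1 - a))); first exact: lambert_param_gt0.
have := mu_lt1 Second (lambert_param_gt0 w0).
by rewrite mu2_param // logL2_param // expRK; lra.
Qed.

Definition tilt_exponent (R : realType) i (vartheta x t : R) : R :=
  t * ln x - logL i x - (t * ln vartheta - logL i vartheta).

(** For [0 < t < 1] this is the tangent inequality at [mu_inv i t], where the slope is [t]; the
    endpoints use [logL1_gt0] and [logL_sub_ln_ge1]. *)
Lemma tilt_exponent_le_rate (R : realType) i (vartheta x t : R) : 0 < x ->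
  ((tilt_exponent i vartheta x t)%:E <= stirling_rate i vartheta t)%E.
Proof.
move=> x0; rewrite /stirling_rate /tilt_exponent.
have [t01|_] := ifPn (0 < t < 1).
  have [y0 yt] := mu_invP i t01.
  have := logL_tangent_le i x0 y0; rewrite yt lee_fin; lra.
have [->|_] := eqVneq t 0.
  case: i; last by rewrite leey.
  by rewrite lee_fin !mul0r; have := logL1_gt0 x0; lra.
have [->|_] := eqVneq t 1; last by rewrite leey.
by rewrite lee_fin; have := logL_sub_ln_ge1 i x0; lra.
Qed.

(* Together with [tilt_exponent_le_rate]: the rate function is the supremum
   over [x] of the affine functions [tilt_exponent i vartheta x]. *)
Lemma lt_rate_tilt_exponent (R : realType) i (vartheta t a : R) :
  (a%:E < stirling_rate i vartheta t)%E ->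
  exists2 x, 0 < x & a < tilt_exponent i vartheta x t.
Proof.
rewrite /stirling_rate /tilt_exponent.
have [t01|t01] := ifPn (0 < t < 1).
  rewrite lte_fin => h; exists (mu_inv i t) => //.
  by have [] := mu_invP i t01.
have [->|t0] := eqVneq t 0.
  case: i; rewrite ?lte_fin => h.
    have [|x x0 ?] := @logL1_arbitrarily_small R (logL First vartheta - a).
      lra.
    by exists x => //; lra.
  have [x x0 ?] := @logL2_unbounded_below R (logL Second vartheta - a).
  by exists x => //; lra.
have [->|t1] := eqVneq t 1.
  rewrite lte_fin => h.
  have [|x x0 ?] := @logL_sub_ln_lt R i (logL i vartheta - 1 - ln vartheta - a).
    lra.
  by exists x => //; lra.
(* Outside [0, 1] the slope [t] is out of the range of [mu], so the exponent is unbounded. At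
   [x = expR s] the tangent inequality gives [logL i x <= logL i 1 + mu i x * s] with [mu i x] in
   (0, 1), and [s] is scaled so that the gain [t * s] (for [t < 0]) or [(t - 1) * s] (for [t > 1])
   is [B]. *)
move=> _; set c := t * ln vartheta - _.
pose B := `|a + logL i 1 + c| + 1.
have hB : a + logL i 1 + c < B.
  by rewrite /B; have := ler_norm (a + logL i 1 + c); lra.
have B0 : 0 < B by rewrite /B; have := normr_ge0 (a + logL i 1 + c); lra.
have [tn|tp] := ltP t 0.
  exists (expR (B / t)); rewrite ?expR_gt0 //; set s := B / t.
  have s0 : s <= 0 by rewrite /s pmulr_rle0 // invr_le0 ltW.
  have ts : t * s = B by rewrite /s; field; lra.
  have := logL_tangent_le i ltr01 (expR_gt0 s); rewrite expRK ln1 ts.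
  have : mu i (expR s) * s <= 0.
    by rewrite pmulr_rle0 // mu_gt0 // expR_gt0.
  lra.
have t1' : 0 < t - 1.
  rewrite subr_gt0 lt_neqAle eq_sym t1 leNgt /=.
  by apply: contra t01 => ->; rewrite lt_neqAle eq_sym t0 tp.
exists (expR (B / (t - 1))); rewrite ?expR_gt0 //.
set s := B / (t - 1).
have s0 : 0 < s by rewrite divr_gt0.
have ts : t * s = B + s by rewrite /s; field; lra.
have := logL_tangent_le i ltr01 (expR_gt0 s).
have := mu_lt1 i (expR_gt0 s).
rewrite expRK ln1 ts -(ltr_pM2r s0) mul1r; lra.
Qed.

Lemma stirling_rate_ge0 (R : realType) i (vartheta t : R) : 0 < vartheta ->
  (0 <= stirling_rate i vartheta t)%E.
Proof.
move=> v0; have := tilt_exponent_le_rate i vartheta t v0.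
by rewrite /tilt_exponent subrr.
Qed.

(** A supremum of continuous functions: one that exceeds [a] at [t] does so nearby and stays below
    the rate. *)
Lemma stirling_rate_lsc (R : realType) i (vartheta : R) :
  lower_semicontinuous (stirling_rate i vartheta).
Proof.
move=> t a /lt_rate_tilt_exponent[x x0 ax].
have cont : {for t, continuous (tilt_exponent i vartheta x)}.
  by rewrite /tilt_exponent; apply: cvgB; apply: cvgB;
    [apply: cvgM; [exact: cvg_id | exact: cvg_cst] | exact: cvg_cst
    |apply: cvgM; [exact: cvg_id | exact: cvg_cst] | exact: cvg_cst].
exists [set y | a < tilt_exponent i vartheta x y].
  exact: cvgr_gt cont _ ax.
move=> y /= ay; apply: lt_le_trans (tilt_exponent_le_rate _ _ _ x0).
by rewrite lte_fin.
Qed.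

(** * Asymptotics of the Stirling polynomials *)

Lemma sumr_shift (V : nmodType) n (F : nat -> V) :
  F 0%N = 0 -> F n.+1 = 0 ->
  \sum_(j < n.+1) F j.+1 = \sum_(k < n.+1) F k.
Proof.
move=> F0 Fn; rewrite big_ord_recr /= Fn addr0.
by rewrite [RHS]big_ord_recl F0 add0r.
Qed.

Lemma stirling_eq0 n i k : (n < k)%N -> stirling i n k = 0%N.
Proof.
case: i => /=; elim: n k => [|n IH] [|k] //= nk;
  by rewrite !IH ?muln0 // ltnW.
Qed.

Lemma stirling_diag_gt0 i n : (0 < stirling i n n)%N.
Proof. by case: i => /=; elim: n => //= n IH; rewrite addn_gt0 IH orbT. Qed.

Lemma stirling_polyE (R : realType) i n (x : R) : (0 < n)%N ->
  stirling_poly i n x = \sum_(k < n.+1) (stirling i n k)%:R * x ^+ k.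
Proof.
case: n => // n _; rewrite /stirling_poly big_add1 /= big_mkord.
by rewrite [RHS]big_ord_recl; case: i => /=; rewrite mul0r add0r.
Qed.

Lemma stirling_poly_gt0 (R : realType) i n (x : R) : (0 < n)%N -> 0 < x ->
  0 < stirling_poly i n x.
Proof.
move=> n0 x0; rewrite stirling_polyE // big_ord_recr /=.
rewrite ltr_wpDl //; last first.
  by rewrite mulr_gt0 ?exprn_gt0 // ltr0n stirling_diag_gt0.
by apply: sumr_ge0 => k _; rewrite mulr_ge0 // exprn_ge0 // ltW.
Qed.

Lemma stirling1_rising (R : realType) n (x : R) :
  \sum_(k < n.+1) (stirling1 n k)%:R * x ^+ k = \prod_(j < n) (x + j%:R).
Proof.
elim: n => [|n IH]; first by rewrite big_ord1 big_ord0 expr0 mulr1.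
rewrite [LHS]big_ord_recl /= mul0r add0r.
rewrite [RHS]big_ord_recr -IH /=.
under eq_bigr do rewrite /bump /= add1n natrD mulrDl.
rewrite big_split /= mulrDr addrC; congr (_ + _).
  by rewrite mulr_suml; apply: eq_bigr => k _; rewrite exprSr mulrA.
rewrite (@sumr_shift _ n (fun k => (n * stirling1 n k)%:R * x ^+ k)).
- rewrite mulr_suml; apply: eq_bigr => k _.
  by rewrite natrM -mulrA mulrC.
- by case: n {IH} => [|n]; rewrite ?mul0n ?muln0 mul0r.
- have -> : stirling1 n n.+1 = 0%N := @stirling_eq0 n First _ (ltnSn n).
  by rewrite muln0 mul0r.
Qed.

(** The induction step is [m * m ^_ k = m ^_ k.+1 + k * m ^_ k], where all terms vanish for
    [k > m]. *)
Lemma stirling2_falling n m :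
  (\sum_(k < n.+1) stirling2 n k * m ^_ k)%N = (m ^ n)%N.
Proof.
elim: n => [|n IH]; first by rewrite big_ord1 expn0.
rewrite [LHS]big_ord_recl /= mul0n add0n expnS -IH big_distrr /=.
under eq_bigr do rewrite /bump /= add1n mulnDl.
rewrite big_split /=.
have -> : (\sum_(i < n.+1) i.+1 * stirling2 n i.+1 * m ^_ i.+1 =
  \sum_(k < n.+1) k * stirling2 n k * m ^_ k)%N.
  apply: (@sumr_shift nat n (fun k => (k * stirling2 n k * m ^_ k)%N)) => //.
  have -> : stirling2 n n.+1 = 0%N := @stirling_eq0 n Second _ (ltnSn n).
  by rewrite muln0.
rewrite -big_split /=; apply: eq_bigr => k _.
rewrite -mulnA mulnCA -mulnDr [RHS]mulnCA; congr (_ * _)%N.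
have [km|mk] := leqP k m; last by rewrite !ffact_small ?muln0 // ltnS ltnW.
by rewrite ffactnSr mulnC -mulnDr addnC subnK // mulnC.
Qed.

(** * Rising factorials and the first kind *)

(** Here [y * ln y - y] is an antiderivative of the increasing function [ln]. *)
Lemma ln_le_increment_xlnx (R : realType) (y : R) : 0 < y ->
  ln y <= ((y + 1) * ln (y + 1) - (y + 1)) - (y * ln y - y) <= ln (y + 1).
Proof.
move=> y0; have y10 : 0 < y + 1 by lra.
have := ln_succ_gt y0; rewrite -(ltr_pM2l y10) divff ?lt0r_neq0 // => h1.
have := ln_succ_lt y0; rewrite -(ltr_pM2l y0) divff ?lt0r_neq0 // => h2.
by apply/andP; split; nra.
Qed.

(** The integral of [ln] lies between its left and right Riemann sums, whose difference telescopes
    to [ln (y + n) - ln y]. *)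
Lemma ln_rising_bounds (R : realType) n (y : R) : 0 < y ->
  ln (\prod_(j < n) (y + j%:R)) <=
    ((y + n%:R) * ln (y + n%:R) - (y + n%:R)) - (y * ln y - y) <=
  ln (\prod_(j < n) (y + j%:R)) + (ln (y + n%:R) - ln y).
Proof.
move=> y0; elim: n => [|n]; first by rewrite big_ord0 ln1 addr0 !subrr addr0 lexx.
have n0 : 0 <= n%:R :> R by [].
have yn0 : 0 < y + n%:R by lra.
rewrite big_ord_recr /= lnM ?posrE //; last first.
  by apply: prodr_gt0 => j _; have : 0 <= j%:R :> R by []; lra.
move=> /andP[h1 h2]; have /andP[h3 h4] := ln_le_increment_xlnx yn0.
have -> : y + n.+1%:R = y + n%:R + 1 by rewrite -natr1 addrA.
by apply/andP; split; lra.
Qed.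

Lemma ln_fact_le (R : realType) n : (0 < n)%N ->
  ln (n`!%:R : R) <= n%:R * ln n%:R - n%:R + 1 + ln n%:R.
Proof.
case: n => // n _; rewrite factS natrM lnM ?posrE ?ltr0n ?fact_gt0 //.
have /andP[h _] := ln_rising_bounds n (@ltr01 R).
have -> : n`!%:R = \prod_(j < n) (1 + j%:R) :> R.
  rewrite fact_prod natr_prod big_add1 big_mkord.
  by apply: eq_bigr => j _; rewrite nat1r.
rewrite ln1 mulr0 sub0r opprK nat1r in h *; lra.
Qed.

Lemma ln_div_nat_cvg0 (R : realType) :
  (fun n => ln n%:R / n%:R : R) @ \oo --> 0.
Proof.
apply/cvgrPdist_le => e e0; near=> n.
have n0 : (0 < n)%N by near: n; exact: nbhs_infty_gt.
have n0' : 0 < n%:R :> R by rewrite ltr0n.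
have ln0 : 0 <= ln n%:R :> R by rewrite ln_ge0 // ler1n.
rewrite sub0r normrN ger0_norm ?divr_ge0 // ler_pdivrMr //.
(* Put [c = e / 2]: one half of [e] pays for [ln (c * n) < c * n], the other for the constant
   [- ln c]. *)
have c0 : 0 < e / 2 by rewrite divr_gt0.
have := ln_sublinear (mulr_gt0 c0 n0'); rewrite lnM ?posrE // => h.
have : - ln (e / 2) / (e / 2) <= n%:R by near: n; exact: nbhs_infty_ger.
by rewrite ler_pdivrMr //; lra.
Unshelve. all: by end_near. Qed.

Lemma natinv_cvg0 (R : realType) : (fun n => n%:R^-1 : R) @ \oo --> 0.
Proof. by rewrite -cvg_shiftS; exact: cvg_harmonic. Qed.

(** At [y = x * n] the bounds of [ln_rising_bounds] have main term [n * (logL First x - 1 + ln n)]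
    and an error [ln (x + 1) - ln x] independent of [n]. *)
Lemma stirling1_poly_cvg (R : realType) (x : R) : 0 < x ->
  (fun n => ln (stirling_poly First n (x * n%:R)) / n%:R - ln n%:R) @ \oo
    --> logL First x - 1.
Proof.
move=> x0; have x10 : 0 < x + 1 by lra.
apply: (@squeeze_cvgr _ _ _ _
  (fun n => logL First x - 1 - (ln (x + 1) - ln x) * n%:R^-1)
  (fun=> logL First x - 1)); last first.
- exact: cvg_cst.
- rewrite -[X in _ --> X]subr0 -(mulr0 (ln (x + 1) - ln x)).
  by apply: cvgB; [exact: cvg_cst|apply: cvgMr; exact: natinv_cvg0].
near=> n; have n0 : (0 < n)%N by near: n; exact: nbhs_infty_gt.
have n0' : 0 < n%:R :> R by rewrite ltr0n.
rewrite stirling_polyE // stirling1_rising.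
have /andP[] := ln_rising_bounds n (mulr_gt0 x0 n0').
set S := ln _.
have -> : x * n%:R + n%:R = (x + 1) * n%:R by ring.
rewrite !lnM ?posrE // => h1 h2.
have E : (x + 1) * n%:R * (ln (x + 1) + ln n%:R) - (x + 1) * n%:R -
  (x * n%:R * (ln x + ln n%:R) - x * n%:R) =
  n%:R * (logL First x - 1 + ln n%:R) by rewrite /logL; ring.
rewrite E in h1 h2.
apply/andP; split.
  rewrite lerBrDr ler_pdivlMr // mulrDl mulrBl mulfVK ?lt0r_neq0 //; lra.
by rewrite lerBlDr ler_pdivrMr //; lra.
Unshelve. all: by end_near. Qed.

(** * Dobinski's formula and the second kind *)

Lemma exp_term_le (R : realType) (x : R) n : 0 <= x ->
  x ^+ n / n`!%:R <= expR x.
Proof.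
move=> x0; case: n => [|n].
  by rewrite expr0 divr1; have := expR_ge1Dx x; lra.
by apply: le_trans (expR_ge1Dxn n x0); rewrite lerDr.
Qed.

Lemma exp_partial_sum_le (R : realType) (x : R) n : 0 <= x ->
  \sum_(k < n) x ^+ k / k`!%:R <= expR x.
Proof.
move=> x0; have -> : \sum_(k < n) x ^+ k / k`!%:R = series (exp_coeff x) n.
  by rewrite /series /= big_mkord.
apply: nondecreasing_cvgn_le; last exact: is_cvg_series_exp_coeff.
by apply: nondecreasing_series => k _ _; exact: exp_coeff_ge0.
Qed.

(** Expanding [m^n] in falling factorials turns this Dobinski term into a sum of
    [stirling2 n k * x^k] times [x^(m - k) / (m - k)!], and the last factor is at most [expR x]. *)
Lemma stirling2_poly_ge (R : realType) (x : R) n m : (0 < n)%N -> 0 <= x ->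
  m%:R ^+ n * x ^+ m / m`!%:R <= expR x * stirling_poly Second n x.
Proof.
move=> n0 x0; rewrite stirling_polyE // -natrX -stirling2_falling natr_sum.
rewrite mulr_suml mulr_suml mulr_sumr; apply: ler_sum => k _ /=.
have [km|mk] := leqP k m; last first.
  by rewrite ffact_small // muln0 !mul0r !mulr_ge0 ?expR_ge0 ?exprn_ge0.
have f0 j : 0 < j`!%:R :> R by rewrite ltr0n fact_gt0.
have -> : (stirling2 n k * m ^_ k)%:R * x ^+ m / m`!%:R =
    (stirling2 n k)%:R * x ^+ k * (x ^+ (m - k) / (m - k)`!%:R) :> R.
  have -> : x ^+ m = x ^+ k * x ^+ (m - k) by rewrite -exprD subnKC.
  rewrite -(ffact_fact km) !natrM.
  have := lt0r_neq0 (f0 (m - k)%N).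
  have : (m ^_ k)%:R != 0 :> R by rewrite pnatr_eq0 -lt0n ffact_gt0.
  move: (m ^_ k)%:R (x ^+ (m - k)) (m - k)`!%:R (x ^+ k) => a b c d a0 c0.
  by field; rewrite a0 c0.
by rewrite mulrC ler_wpM2r ?exp_term_le // mulr_ge0 // exprn_ge0.
Qed.

(** The product on the left only reaches indices [m = k + j < n + N], since [k <= n] and [j < N];
    all further terms on the right are nonnegative. *)
Lemma dobinski_truncated_le (R : realType) (x : R) n N : (0 < n)%N -> 0 <= x ->
  stirling_poly Second n x * \sum_(j < N) x ^+ j / j`!%:R <=
  \sum_(m < n + N) m%:R ^+ n * x ^+ m / m`!%:R.
Proof.
move=> n0 x0; rewrite stirling_polyE // mulr_suml.
under [leRHS]eq_bigr do
  rewrite -natrX -stirling2_falling natr_sum mulr_suml mulr_suml.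
rewrite exchange_big /=; apply: ler_sum => k _ /=.
have f0 j : 0 < j`!%:R :> R by rewrite ltr0n fact_gt0.
have kN : (n + N = k + (n - k + N))%N by rewrite addnA subnKC // -ltnS.
rewrite kN big_split_ord /= -[leLHS]add0r lerD //.
  by apply: sumr_ge0 => m _; rewrite !mulr_ge0 ?exprn_ge0 // invr_ge0 ltW.
rewrite addnC big_split_ord /= -[leLHS]addr0 lerD //; last first.
  by apply: sumr_ge0 => m _; rewrite !mulr_ge0 ?exprn_ge0 // invr_ge0 ltW.
rewrite mulr_sumr; apply: ler_sum => j _ /=.
rewrite le_eqVlt; apply/orP; left; apply/eqP.
have km : (k <= k + j)%N by rewrite leq_addr.
rewrite -(ffact_fact km) !natrM addKn exprD.
have := lt0r_neq0 (f0 j).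
have : ((k + j) ^_ k)%:R != 0 :> R by rewrite pnatr_eq0 -lt0n ffact_gt0.
move: ((k + j) ^_ k)%:R (x ^+ j) j`!%:R (x ^+ k) => a b c d a0 c0.
by field; rewrite a0 c0.
Qed.

(** Since [(z * m)^n / n!] is a term of the series of [expR (z * m)], Dobinski's series is dominated
    by an exponential series at [x * expR z]; then [N] tends to infinity. *)
Lemma stirling2_poly_le (R : realType) (x z : R) n : (0 < n)%N -> 0 <= x ->
  0 < z ->
  stirling_poly Second n x * expR x <= n`!%:R / z ^+ n * expR (x * expR z).
Proof.
move=> n0 x0 z0.
have f0 j : 0 < j`!%:R :> R by rewrite ltr0n fact_gt0.
have zn0 : 0 < z ^+ n by rewrite exprn_gt0.
have H N : stirling_poly Second n x * series (exp_coeff x) N <=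
    n`!%:R / z ^+ n * expR (x * expR z).
  rewrite /series /= big_mkord.
  apply: (le_trans (dobinski_truncated_le N n0 x0)).
  have e0 : 0 <= x * expR z by rewrite mulr_ge0 ?expR_ge0.
  have := exp_partial_sum_le (n + N) e0.
  rewrite -(@ler_pM2l _ (n`!%:R / z ^+ n)) ?divr_gt0 //.
  apply: le_trans; rewrite mulr_sumr; apply: ler_sum => m _.
  rewrite mulrA ler_pM2r ?invr_gt0 // exprMn -expRM_natr mulrCA (mulrC (x ^+ m)).
  rewrite ler_wpM2r ?exprn_ge0 // mulrAC ler_pdivlMr //.
  have mz : 0 <= z * m%:R by rewrite mulr_ge0 // ltW.
  have := exp_term_le n mz.
  by rewrite ler_pdivrMr // exprMn; lra.
have cv : (fun N => stirling_poly Second n x * series (exp_coeff x) N) @ \oo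
    --> stirling_poly Second n x * expR x.
  by apply: cvgMr; exact: is_cvg_series_exp_coeff.
by rewrite -(cvg_lim _ cv) //; apply: limr_le; [exact: cvgP cv | exact: nearW].
Qed.

Lemma truncn_div_cvg (R : realType) (u : R) : 0 < u ->
  (fun n => (Num.truncn (u * n%:R))%:R / n%:R : R) @ \oo --> u.
Proof.
move=> u0; apply: (@squeeze_cvgr _ _ _ _ (fun n => u - n%:R^-1) (fun=> u));
  last first.
- exact: cvg_cst.
- rewrite -[X in _ --> X]subr0.
  by apply: cvgB; [exact: cvg_cst|exact: natinv_cvg0].
near=> n; have n0 : (0 < n)%N by near: n; exact: nbhs_infty_gt.
have n0' : 0 < n%:R :> R by rewrite ltr0n.
have /truncn_itv/andP[h1 h2] : 0 <= u * n%:R by rewrite mulr_ge0 // ltW.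
rewrite ler_pdivlMr // ler_pdivrMr // h1 andbT mulrBl mulVf ?lt0r_neq0 //.
by move: h2; rewrite -natr1; lra.
Unshelve. all: by end_near. Qed.

(** Both bounds are taken at their optimum: for [w = W_0(1/x)] the Dobinski terms at [x * n] are
    largest near [m = n / w], and the upper bound is smallest at [z = w]. The exponents agree
    because [x * expR w = w^-1]. *)
Lemma stirling2_poly_cvg (R : realType) (x : R) : 0 < x ->
  (fun n => ln (stirling_poly Second n (x * n%:R)) / n%:R - ln n%:R) @ \oo
    --> logL Second x - 1.
Proof.
move=> x0; have [w w0 xw] := lambert_param_surj x0.
pose u := w^-1; have u0 : 0 < u by rewrite invr_gt0.
pose v (n : nat) : R := (Num.truncn (u * n%:R))%:R / n%:R.
have cv : v @ \oo --> u by exact: truncn_div_cvg.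
have cl : (fun n => ln n%:R / n%:R : R) @ \oo --> 0 by exact: ln_div_nat_cvg0.
have ci : (fun n => n%:R^-1 : R) @ \oo --> 0 by exact: natinv_cvg0.
have lnu : ln u = - ln w by rewrite lnV ?posrE.
have Lw : logL Second x = u - x - ln w.
  by rewrite -xw logL2_param // /lambert_param /u mulrBl mul1r.
have lnx : ln x = - w - ln w by rewrite -xw ln_lambert_param.
have xu : x * expR w = u.
  by rewrite -xw /lambert_param mulrAC -expRD addNr expR0 mul1r.
apply: (@squeeze_cvgr _ _ _ _
  (fun n => ln (v n) + v n * ln x - v n * ln (v n) + v n - x
     - (1 + ln u) * n%:R^-1 - ln n%:R / n%:R)
  (fun n => logL Second x - 1 + (n%:R^-1 + ln n%:R / n%:R))).
- near=> n; have n0 : (0 < n)%N by near: n; exact: nbhs_infty_gt.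
  have n0' : 0 < n%:R :> R by rewrite ltr0n.
  have xn0 : 0 < x * n%:R by rewrite mulr_gt0.
  have Z0 := @stirling_poly_gt0 R Second n _ n0 xn0.
  set Z := stirling_poly _ _ _ in Z0 *.
  have v0 : 0 < v n.
    near: n; exact: cvgr_gt cv _ u0.
  pose m := Num.truncn (u * n%:R).
  have vm : (m%:R : R) = v n * n%:R by rewrite /v divfK ?lt0r_neq0.
  have m0 : 0 < m%:R :> R by rewrite vm mulr_gt0.
  have mu_n : m%:R <= u * n%:R by rewrite truncn_le mulr_ge0 // ltW.
  move: (v n) v0 vm => vn v0 vm; clearbody m.
  apply/andP; split.
    have lm : ln m%:R <= ln u + ln n%:R :> R.
      by rewrite -lnM ?posrE // ler_ln ?posrE // mulr_gt0.
    have := stirling2_poly_ge m n0 (ltW xn0); rewrite -/Z.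
    have f0 : 0 < m`!%:R :> R by rewrite ltr0n fact_gt0.
    rewrite -ler_ln ?posrE ?divr_gt0 ?mulr_gt0 ?exprn_gt0 ?expR_gt0 //.
    rewrite ln_div ?posrE ?mulr_gt0 ?exprn_gt0 //.
    rewrite !lnM ?posrE ?exprn_gt0 ?expR_gt0 //.
    rewrite !lnXn // expRK lnM ?posrE //.
    rewrite -(mulr_natr (ln m%:R) n) -(mulr_natr (ln x + _) m) => h.
    have := @ln_fact_le R m; rewrite -(ltr0n R) m0 => /(_ isT) => hf.
    have lnm : ln m%:R = ln vn + ln n%:R :> R by rewrite vm lnM ?posrE.
    rewrite lerBrDr ler_pdivlMr //.
    apply: le_trans (_ : n%:R * ln m%:R + m%:R * (ln x + ln n%:R)
      - (m%:R * ln m%:R - m%:R + 1 + (ln u + ln n%:R)) - x * n%:R <= _); last lra.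
    by rewrite lnm vm le_eqVlt; apply/orP; left; apply/eqP; field; lra.
  have := @stirling2_poly_le R _ w n n0 (ltW xn0) w0; rewrite -/Z.
  have f0 : 0 < n`!%:R :> R by rewrite ltr0n fact_gt0.
  have wn0 : 0 < w ^+ n by rewrite exprn_gt0.
  rewrite -ler_ln ?posrE; [|by rewrite mulr_gt0 ?expR_gt0
    |by rewrite mulr_gt0 ?divr_gt0 ?expR_gt0].
  rewrite !lnM ?posrE ?invr_gt0 ?divr_gt0 ?exprn_gt0 ?expR_gt0 //.
  rewrite lnV ?posrE ?exprn_gt0 // lnXn // !expRK.
  rewrite -(mulr_natr (ln w) n) (mulrAC x) xu => h.
  have hf := @ln_fact_le R n n0.
  rewrite lerBlDr ler_pdivrMr //.
  have -> : (logL Second x - 1 + (n%:R^-1 + ln n%:R / n%:R) + ln n%:R) * n%:R =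
    (n%:R * ln n%:R - n%:R + 1 + ln n%:R) - ln w * n%:R + u * n%:R - x * n%:R.
    by rewrite Lw; field; lra.
  lra.
- have -> : logL Second x - 1 =
    ln u + u * ln x - u * ln u + u - x - (1 + ln u) * 0 - 0.
    by rewrite Lw lnx lnu /u; field; lra.
  have clv : (fun n => ln (v n)) @ \oo --> ln u.
    by apply: continuous_cvg cv; exact: continuous_ln.
  apply: cvgB; last exact: cl.
  apply: cvgB; last exact: cvgMr.
  apply: cvgB; last exact: cvg_cst.
  apply: cvgD; last exact: cv.
  apply: cvgB; last exact: cvgM cv clv.
  by apply: cvgD; [exact: clv | apply: cvgM; [exact: cv | exact: cvg_cst]].
- rewrite -[X in _ --> X]addr0 -[X in _ --> _ + X]addr0.
  apply: cvgD; first exact: cvg_cst.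
  exact: cvgD ci cl.
Unshelve. all: by end_near. Qed.

Lemma stirling_poly_cvg (R : realType) i (x : R) : 0 < x ->
  (fun n => ln (stirling_poly i n (x * n%:R)) / n%:R - ln n%:R) @ \oo
    --> logL i x - 1.
Proof. by case: i; [exact: stirling1_poly_cvg | exact: stirling2_poly_cvg]. Qed.

(** * The large deviations principle *)

(** The mass of [A] under the law of [X / n], left unnormalised so that a change of [x] acts term by
    term. *)
Definition stirling_weight (R : realType) i n (x : R) (A : set R) : R :=
  \sum_(1 <= k < n.+1 | k%:R / n%:R \in A)
    (stirling i n k)%:R * (x * n%:R) ^+ k.

Lemma stirling_weight_ge0 (R : realType) i n (x : R) A : 0 < x ->
  0 <= stirling_weight i n x A.
Proof.
move=> x0; apply: sumr_ge0 => k _.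
by rewrite mulr_ge0 // exprn_ge0 // mulr_ge0 // ltW.
Qed.

Lemma stirling_weightT (R : realType) i n (x : R) :
  stirling_weight i n x setT = stirling_poly i n (x * n%:R).
Proof. by apply: eq_bigl => k; apply: mem_set. Qed.

Lemma stirling_weightC (R : realType) i n (x : R) A :
  stirling_weight i n x A + stirling_weight i n x (~` A) =
  stirling_poly i n (x * n%:R).
Proof.
rewrite /stirling_poly (bigID (fun k : nat => k%:R / n%:R \in A)) /=.
by congr (_ + _); apply: eq_bigl => k; rewrite classical_sets.in_setC.
Qed.

Lemma stirling_weight_le (R : realType) i n (x : R) (A B : set R) : 0 < x ->
  A `<=` B -> stirling_weight i n x A <= stirling_weight i n x B.
Proof.
move=> x0 AB; rewrite /stirling_weight big_mkcond [leRHS]big_mkcond.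
apply: ler_sum => k _; case: ifPn => [/set_mem/AB/mem_set -> //|_].
by case: ifPn => // _; rewrite mulr_ge0 // exprn_ge0 // mulr_ge0 // ltW.
Qed.

Lemma stirling_weightU (R : realType) i n (x : R) (A B C : set R) : 0 < x ->
  A `<=` B `|` C ->
  stirling_weight i n x A <= stirling_weight i n x B + stirling_weight i n x C.
Proof.
move=> x0 ABC; rewrite /stirling_weight big_mkcond [X in X + _]big_mkcond.
rewrite [X in _ + X]big_mkcond -big_split; apply: ler_sum => k _ /=.
have w0 : 0 <= (stirling i n k)%:R * (x * n%:R) ^+ k.
  by rewrite mulr_ge0 // exprn_ge0 // mulr_ge0 // ltW.
have [/set_mem/ABC|_] := boolP (_ \in A).
  by case=> /mem_set ->; case: ifP; lra.
by case: ifP; case: ifP; lra.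
Qed.

(** The [k]-th term is multiplied by [(y / x)^k = expR (n * s * (ln y - ln x))] with [s = k / n]. *)
Lemma stirling_weight_tilt (R : realType) i n (x y c : R) (A : set R) :
  (0 < n)%N -> 0 < x -> 0 < y ->
  (forall s, A s -> s * (ln y - ln x) <= c) ->
  stirling_weight i n y A <= expR (n%:R * c) * stirling_weight i n x A.
Proof.
move=> n0 x0 y0 Ac; rewrite /stirling_weight mulr_sumr.
apply: ler_sum => k /set_mem/Ac kc.
have n0' : 0 < n%:R :> R by rewrite ltr0n.
have -> : y = x * expR (ln y - ln x).
  by rewrite expRB !lnK ?posrE // mulrC divfK // lt0r_neq0.
rewrite mulrCA ler_wpM2l // (mulrAC x) exprMn mulrC.
rewrite ler_wpM2r ?exprn_ge0 ?mulr_ge0 ?(ltW x0) // -expRM_natl ler_expR.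
by rewrite -ler_pdivrMl // mulrA (mulrC _^-1).
Qed.

Lemma measurable_scaled_preimage (R : realType) d (T : measurableType d)
    (P : probability T R) (X : {RV P >-> R}) n (A : set R) : measurable A ->
  measurable ((fun w => X w / n%:R) @^-1` A).
Proof.
move=> mA; have mXn : measurable_fun setT (fun w => X w / n%:R).
  by apply: measurable_realfun.measurable_funM => //; exact: measurable_cst.
by have := mXn measurableT A mA; rewrite setTI.
Qed.

(** The hypothesis gives only the atoms 1, ..., [n], and the event contains the disjoint union of
    those in [A]. Applied also to the complement, this forces equality in [prob_stirling], as the
    two weights add up to the whole polynomial. *)
Lemma prob_stirling_ge (R : realType) i n (vartheta : R) d (T : measurableType d)
    (P : probability T R) (X : {RV P >-> R}) (A : set R) : (0 < n)%N ->
  stirling_distributed i n (vartheta * n%:R) X -> measurable A ->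
  ((stirling_weight i n vartheta A /
      stirling_poly i n (vartheta * n%:R))%R%:E
    <= P ((fun w => X w / n%:R)%R @^-1` A))%E.
Proof.
move=> n0 hX mA; have n0' : n%:R != 0 :> R by rewrite pnatr_eq0 -lt0n.
pose D (k : nat) := (1 <= k)%N && (k%:R / n%:R \in A).
pose E k := if D k then [set w | X w = k%:R] else set0.
have mX (k : nat) : measurable [set w | X w = k%:R].
  have := @measurable_funPT _ _ _ _ X measurableT [set k%:R] (measurable_set1 _).
  by rewrite setTI.
have mE k : measurable (E k) by rewrite /E; case: ifP.
have tE : trivIset setT E.
  apply/trivIsetP => j k _ _ jk; rewrite /E.
  case: ifP => _; rewrite ?set0I //; case: ifP => _; rewrite ?setI0 //.
  apply/seteqP; split=> // w /= [-> /eqP]; rewrite eqr_nat => /eqP e.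
  by rewrite e eqxx in jk.
have mXA := measurable_scaled_preimage X n mA.
have <- : P (\big[setU/set0]_(k < n.+1) E k) =
    (stirling_weight i n vartheta A / stirling_poly i n (vartheta * n%:R))%:E.
  rewrite measure_bigsetU // /stirling_weight big_add1 mulr_suml.
  rewrite -sumEFin big_ord_recl /= {1}/E /= measure0 add0e big_mkord.
  rewrite [RHS]big_mkcond.
  apply: eq_bigr => k _; rewrite /E /D /= /bump /= add1n.
  case: ifP => _; last by rewrite measure0.
  by rewrite hX // ltn_ord.
apply: le_measure; rewrite ?inE //.
  by apply: bigsetU_measurable => k _.
rewrite -bigcup_mkord => w [k /= kn]; rewrite /E.
case: ifP => // /andP[_ kA] /= ->.
exact: set_mem kA.
Qed.

Lemma prob_stirling (R : realType) i n (vartheta : R) d (T : measurableType d)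
    (P : probability T R) (X : {RV P >-> R}) (A : set R) :
  (0 < n)%N -> 0 < vartheta ->
  stirling_distributed i n (vartheta * n%:R) X -> measurable A ->
  P ((fun w => X w / n%:R) @^-1` A) =
  (stirling_weight i n vartheta A / stirling_poly i n (vartheta * n%:R))%:E.
Proof.
move=> n0 v0 hX mA; apply/eqP; rewrite eq_le prob_stirling_ge // andbT.
have n0' : 0 < n%:R :> R by rewrite ltr0n.
have Z0 := @stirling_poly_gt0 R i n _ n0 (mulr_gt0 v0 n0').
have mXA := measurable_scaled_preimage X n mA.
have := prob_stirling_ge n0 hX (measurableC mA).
rewrite preimage_setC probability_setC //.
rewrite -(fineK (fin_num_measure P _ mXA)) -EFinB !lee_fin.
have -> : stirling_weight i n vartheta (~` A) =
    stirling_poly i n (vartheta * n%:R) - stirling_weight i n vartheta A.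
  by rewrite -(stirling_weightC i n vartheta A); ring.
by rewrite mulrBl divff ?lt0r_neq0 //; lra.
Qed.

(** * Order and limit facts on the real and extended real lines *)

Lemma limn_esup_le_near (R : realType) (u : (\bar R)^nat) (c : \bar R) :
  (\forall n \near \oo, (u n <= c)%E) -> (limn_esup u <= c)%E.
Proof.
move=> uc; rewrite /limn_esup limf_esupE; apply: ge_ereal_inf.
exists (ereal_sup (u @` [set n | (u n <= c)%E])).
  by exists [set n | (u n <= c)%E].
by apply: ge_ereal_sup => _ [n /= ? <-].
Qed.

Lemma limn_einf_ge_near (R : realType) (u : (\bar R)^nat) (c : \bar R) :
  (\forall n \near \oo, (c <= u n)%E) -> (c <= limn_einf u)%E.
Proof.
move=> cu; rewrite /limn_einf leeNr; apply: limn_esup_le_near.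
by apply: filterS cu => n; rewrite leeN2.
Qed.

Lemma lee_lt_EFin (R : realType) (x y : \bar R) :
  (forall a : R, (a%:E < x)%E -> (a%:E <= y)%E) -> (x <= y)%E.
Proof.
move=> h; rewrite leNgt; apply/negP => yx.
case: x y h yx => [x| |] [y| |] h //=.
- rewrite lte_fin => yx; have := h ((x + y) / 2); rewrite lte_fin lee_fin.
  by move=> H; have : (x + y) / 2 <= y; [apply: H; lra | lra].
- by move=> _; have := h (x - 1); rewrite lte_fin ltrBlDr ltrDl ltr01 => /(_ isT).
- by move=> _; have := h (y + 1); rewrite ltry lee_fin gerDl ler10 => /(_ isT).
- by move=> _; have := h 0; rewrite ltry => /(_ isT).
Qed.

Lemma scaled_lne_le (R : realType) n (p a : R) : (0 < n)%N -> 0 <= p ->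
  p <= expR (n%:R * a) -> (n%:R^-1%:E * lne p%:E <= a%:E)%E.
Proof.
move=> n0; have n0' : 0 < n%:R :> R by rewrite ltr0n.
rewrite le_eqVlt => /predU1P[<- _|p0 h].
  by rewrite le0_lneNy // gt0_muleNy ?leNye // lte_fin invr_gt0.
rewrite lne_EFin // -EFinM lee_fin mulrC ler_pdivrMr // mulrC.
by rewrite -ler_expR lnK.
Qed.

Lemma scaled_lne_ge (R : realType) n (p a : R) : (0 < n)%N ->
  expR (n%:R * a) <= p -> (a%:E <= n%:R^-1%:E * lne p%:E)%E.
Proof.
move=> n0 h; have n0' : 0 < n%:R :> R by rewrite ltr0n.
have p0 : 0 < p by apply: lt_le_trans h; exact: expR_gt0.
rewrite lne_EFin // -EFinM lee_fin mulrC ler_pdivlMr // mulrC.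
by rewrite -ler_expR lnK.
Qed.

Lemma closed_has_max (R : realType) (A : set R) :
  closed A -> A !=set0 -> has_ubound A -> exists2 a, A a & ubound A a.
Proof.
move=> cA A0 Ab; exists (sup A); last by move=> a Aa; exact: ub_le_sup.
by move/closure_id: cA => e; rewrite {1}e; exact: closure_sup.
Qed.

Lemma closed_has_min (R : realType) (A : set R) :
  closed A -> A !=set0 -> has_lbound A -> exists2 a, A a & lbound A a.
Proof.
move=> cA [a0 Aa0] [b Ab].
have [|||a Aa ua] := @closed_has_max R (-%R @^-1` A).
- by apply: closed_comp cA => x _; exact: opp_continuous.
- by exists (- a0); rewrite /= opprK.
- by exists (- b) => x /Ab; lra.
exists (- a) => // x Ax; have := ua (- x); rewrite /= opprK => /(_ Ax); lra.
Qed.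

Lemma ln_lt_of_mu_lt (R : realType) i (x y : R) : 0 < x -> 0 < y ->
  mu i x < mu i y -> ln x < ln y.
Proof.
move=> x0 y0 h; rewrite ltNge; apply/negP => yx.
have xy : x != y by apply: contraTneq h => ->; rewrite ltxx.
have := logL_tangent i x0 y0 xy; rewrite eq_sym in xy.
by have := logL_tangent i y0 x0 xy; nra.
Qed.

(** * Chernoff bounds and the two halves of the principle *)

Section stirling_ldp.
Context {R : realType} (i : kind) (vartheta : R) (vartheta_gt0 : 0 < vartheta).

Local Notation Z n x := (stirling_poly i n (x * n%:R)).
Local Notation W := (stirling_weight i).
Local Notation L := (logL i).
Local Notation rate := (stirling_rate i vartheta).

(** The divergent [ln n] cancels in the ratio. The constant [k] makes room for factors such as 2 or
    4, invisible on the exponential scale. *)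
Lemma ln_stirling_ratio_cvg (k x y : R) : 0 < x -> 0 < y ->
  (fun n => (ln (Z n x / Z n y) + k) / n%:R) @ \oo --> L x - L y.
Proof.
move=> x0 y0.
have -> : L x - L y = (L x - 1) - (L y - 1) + k * 0 by ring.
have ck : (fun n => k * n%:R^-1 : R) @ \oo --> k * 0.
  by apply: cvgMr; exact: natinv_cvg0.
have H := cvgD (cvgB (@stirling_poly_cvg R i x x0)
  (@stirling_poly_cvg R i y y0)) ck.
suff E : {near \oo, (fun n => (ln (Z n x) / n%:R - ln n%:R) -
    (ln (Z n y) / n%:R - ln n%:R) + k * n%:R^-1) =1
    (fun n => (ln (Z n x / Z n y) + k) / n%:R)}.
  by apply: cvg_trans (near_eq_cvg E) _; exact: H.
near=> n.
have n0 : (0 < n)%N by near: n; exact: nbhs_infty_gt.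
have n0' : 0 < n%:R :> R by rewrite ltr0n.
by rewrite /= ln_div ?posrE ?stirling_poly_gt0 ?mulr_gt0 //; field; lra.
Unshelve. all: by end_near. Qed.

Lemma stirling_ratio_lt (k b x y : R) : 0 < x -> 0 < y -> L x - L y < b ->
  \forall n \near \oo, expR k * (Z n x / Z n y) <= expR (n%:R * b).
Proof.
move=> x0 y0 h; near=> n.
have n0 : (0 < n)%N by near: n; exact: nbhs_infty_gt.
have n0' : 0 < n%:R :> R by rewrite ltr0n.
have q0 : 0 < Z n x / Z n y.
  by rewrite divr_gt0 ?stirling_poly_gt0 ?mulr_gt0.
have : (ln (Z n x / Z n y) + k) / n%:R < b.
  by near: n; exact: cvgr_lt (ln_stirling_ratio_cvg k x0 y0) _ h.
rewrite ltr_pdivrMr // -{2}(lnK (q0 : _ \in Num.pos)) -expRD ler_expR; lra.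
Unshelve. all: by end_near. Qed.

Lemma stirling_ratio_gt (k b x y : R) : 0 < x -> 0 < y -> b < L x - L y ->
  \forall n \near \oo, expR (n%:R * b) <= expR k * (Z n x / Z n y).
Proof.
move=> x0 y0 h; near=> n.
have n0 : (0 < n)%N by near: n; exact: nbhs_infty_gt.
have n0' : 0 < n%:R :> R by rewrite ltr0n.
have q0 : 0 < Z n x / Z n y.
  by rewrite divr_gt0 ?stirling_poly_gt0 ?mulr_gt0.
have : b < (ln (Z n x / Z n y) + k) / n%:R.
  by near: n; exact: cvgr_gt (ln_stirling_ratio_cvg k x0 y0) _ h.
rewrite ltr_pdivlMr // -{2}(lnK (q0 : _ \in Num.pos)) -expRD ler_expR; lra.
Unshelve. all: by end_near. Qed.

Lemma chernoff (k c b x y : R) (A : set R) : 0 < x -> 0 < y ->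
  (forall s, A s -> s * (ln y - ln x) <= c) -> c + (L x - L y) < b ->
  \forall n \near \oo, expR k * (W n y A / Z n y) <= expR (n%:R * b).
Proof.
move=> x0 y0 Ac cb; have h : L x - L y < b - c by lra.
near=> n; have n0 : (0 < n)%N by near: n; exact: nbhs_infty_gt.
have n0' : 0 < n%:R :> R by rewrite ltr0n.
have Z0 : 0 < Z n y by rewrite stirling_poly_gt0 ?mulr_gt0.
have : expR k * (Z n x / Z n y) <= expR (n%:R * (b - c)).
  by near: n; exact: stirling_ratio_lt.
rewrite mulrBr expRB ler_pdivlMr ?expR_gt0 //; apply: le_trans.
have -> : expR k * (Z n x / Z n y) * expR (n%:R * c) =
  expR k * (expR (n%:R * c) * Z n x / Z n y) by ring.
rewrite ler_wpM2l ?expR_ge0 // ler_wpM2r ?invr_ge0 ?(ltW Z0) //.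
apply: (le_trans (stirling_weight_tilt i n0 x0 y0 Ac)).
rewrite ler_wpM2l ?expR_ge0 // -stirling_weightT.
exact: stirling_weight_le.
Unshelve. all: by end_near. Qed.

(** The sign condition says that [A] lies beyond [t] as seen from the mean [mu i vartheta], so one
    statement covers both tails. *)
Lemma chernoff_rate (k a t : R) (A : set R) : 0 <= a -> (a%:E < rate t)%E ->
  (forall s, A s -> 0 <= (s - t) * (t - mu i vartheta)) ->
  \forall n \near \oo,
    expR k * (W n vartheta A / Z n vartheta) <= expR (n%:R * - a).
Proof.
move=> a0 /lt_rate_tilt_exponent[x x0]; rewrite /tilt_exponent => h At.
apply: (@chernoff k (t * (ln vartheta - ln x)) _ x) => //; last by lra.
move=> s /At; have := logL_tangent_le i x0 vartheta_gt0.
set m := mu i vartheta => hm st.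
(* A positive exponent at [t] forces [x] to lie on the same side of [vartheta] as [t] does of
   [m]. *)
have q0 : 0 < (t - m) * (ln x - ln vartheta) by lra.
rewrite -subr_ge0.
have -> : t * (ln vartheta - ln x) - s * (ln vartheta - ln x) =
  (s - t) * (ln x - ln vartheta) by ring.
have tm : t - m != 0.
  by apply: contraTneq q0 => ->; rewrite mul0r ltxx.
have := mulr_ge0 st (ltW q0).
have -> : (s - t) * (t - m) * ((t - m) * (ln x - ln vartheta)) =
  (t - m) ^+ 2 * ((s - t) * (ln x - ln vartheta)) by ring.
by rewrite pmulr_rge0 // exprn_even_gt0.
Qed.

Lemma rate_at_mean : (rate (mu i vartheta) <= 0)%E.
Proof.
rewrite /stirling_rate mu_gt0 // mu_lt1 //= mu_inv_unique //.
by rewrite subrr.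
Qed.

Lemma ldp_upper (a : R) (F : set R) : closed F -> 0 <= a ->
  (forall t, F t -> (a%:E < rate t)%E) ->
  \forall n \near \oo, W n vartheta F / Z n vartheta <= expR (n%:R * - a).
Proof.
move=> cF a0 aF; set m := mu i vartheta.
(* The set [F] is cut at the mean; the factor 2 lets each piece use half of the bound. *)
have half (A : set R) : (A = set0 \/ exists2 t, F t &
      forall s, A s -> 0 <= (s - t) * (t - m)) ->
    \forall n \near \oo, 2 * (W n vartheta A / Z n vartheta)
      <= expR (n%:R * - a).
  case=> [->|[t Ft At]].
    apply: nearW => n.
    rewrite /stirling_weight big_pred0 ?mul0r ?mulr0 ?expR_ge0 //.
    by move=> k; apply/negbTE/negP => /set_mem.
  have := @chernoff_rate (ln 2) a t A a0 (aF _ Ft) At.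
  by rewrite lnK // posrE.
have left : \forall n \near \oo, 2 * (W n vartheta (F `&` [set s | s <= m]) /
    Z n vartheta) <= expR (n%:R * - a).
  apply: half; have [->|/set0P ne] := eqVneq (F `&` [set s | s <= m]) set0.
    by left.
  right; have [|t [Ft tm] ub] := closed_has_max (closedI cF (@closed_le R m)) ne.
    by exists m => s [].
  exists t => // s /ub st; rewrite /= in tm.
  by rewrite -mulrNN mulr_ge0 //; lra.
have right : \forall n \near \oo, 2 * (W n vartheta (F `&` [set s | m <= s]) /
    Z n vartheta) <= expR (n%:R * - a).
  apply: half; have [->|/set0P ne] := eqVneq (F `&` [set s | m <= s]) set0.
    by left.
  right; have [|t [Ft tm] lb] := closed_has_min (closedI cF (@closed_ge R m)) ne.
    by exists m => s [].
  exists t => // s /lb st; rewrite /= in tm.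
  by rewrite mulr_ge0 //; lra.
near=> n; have n0 : (0 < n)%N by near: n; exact: nbhs_infty_gt.
have n0' : 0 < n%:R :> R by rewrite ltr0n.
have Z0 : 0 < Z n vartheta by rewrite stirling_poly_gt0 ?mulr_gt0.
apply: (@le_trans _ _ (W n vartheta (F `&` [set s | s <= m]) / Z n vartheta +
    W n vartheta (F `&` [set s | m <= s]) / Z n vartheta)).
  rewrite -mulrDl ler_wpM2r ?invr_ge0 ?(ltW Z0) // stirling_weightU //.
  move=> s Fs /=; have [sm|ms] := leP s m; first by left.
  by right; split=> //; exact: ltW.
have : 2 * (W n vartheta (F `&` [set s | s <= m]) / Z n vartheta)
  <= expR (n%:R * - a) by near: n.
have : 2 * (W n vartheta (F `&` [set s | m <= s]) / Z n vartheta)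
  <= expR (n%:R * - a) by near: n.
lra.
Unshelve. all: by end_near. Qed.

Lemma tail_small (c x y : R) (A : set R) : 0 < x -> 0 < y ->
  (forall s, A s -> s * (ln y - ln x) <= c) -> c + (L x - L y) < 0 ->
  \forall n \near \oo, W n y A <= Z n y / 4.
Proof.
move=> x0 y0 Ac c0; have := chernoff (ln 4) x0 y0 Ac c0.
move=> h; near=> n; have n0 : (0 < n)%N by near: n; exact: nbhs_infty_gt.
have n0' : 0 < n%:R :> R by rewrite ltr0n.
have Z0 : 0 < Z n y by rewrite stirling_poly_gt0 ?mulr_gt0.
have : expR (ln 4) * (W n y A / Z n y) <= expR (n%:R * 0) by near: n.
rewrite mulr0 expR0 lnK ?posrE // mulrA ler_pdivrMr //; lra.
Unshelve. all: by end_near. Qed.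

(** Each tail is tilted to the parameter whose mean is its boundary point [t + e] or [t - e];
    strictness of the tangent inequality there makes the Chernoff exponent negative. *)
Lemma tilted_law_concentrates (t e : R) : 0 < t - e -> t + e < 1 -> 0 < e ->
  let x := mu_inv i t in
  \forall n \near \oo, Z n x / 2 <= W n x [set s | t - e < s < t + e].
Proof.
move=> te0 te1 e0 x.
have [|x0 xt] := @mu_invP R i t; first by apply/andP; split; lra.
have [|y0 yt] := @mu_invP R i (t + e); first by apply/andP; split; lra.
have [|z0 zt] := @mu_invP R i (t - e); first by apply/andP; split; lra.
rewrite -/x in x0 xt; set y := mu_inv i (t + e) in y0 yt.
set z := mu_inv i (t - e) in z0 zt.
have xy : ln x < ln y by apply: (@ln_lt_of_mu_lt R i) => //; lra.
have zx : ln z < ln x by apply: (@ln_lt_of_mu_lt R i) => //; lra.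
have up : \forall n \near \oo, W n x [set s | t + e <= s] <= Z n x / 4.
  apply: (@tail_small ((t + e) * (ln x - ln y)) y) => //.
    by move=> s /= h; rewrite ler_wnM2r //; lra.
  have xy' : x != y by apply: contraTneq xy => ->; rewrite ltxx.
  by have := logL_tangent i x0 y0 xy'; rewrite yt; lra.
have down : \forall n \near \oo, W n x [set s | s <= t - e] <= Z n x / 4.
  apply: (@tail_small ((t - e) * (ln x - ln z)) z) => //.
    by move=> s /= h; rewrite ler_wpM2r //; lra.
  have xz' : x != z by apply: contraTneq zx => ->; rewrite ltxx.
  by have := logL_tangent i x0 z0 xz'; rewrite zt; lra.
near=> n.
have h1 : W n x [set s | t + e <= s] <= Z n x / 4 by near: n.
have h2 : W n x [set s | s <= t - e] <= Z n x / 4 by near: n.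
set B := [set s | t - e < s < t + e].
have h3 : W n x (~` B) <=
    W n x [set s | t + e <= s] + W n x [set s | s <= t - e].
  apply: stirling_weightU => // s /= /negP.
  by rewrite negb_and -!leNgt => /orP[]; [right|left].
by have := stirling_weightC i n x B; lra.
Unshelve. all: by end_near. Qed.

Lemma ldp_lower_interior (t e : R) (G : set R) : open G -> G t ->
  0 < t < 1 -> 0 < e ->
  let x := mu_inv i t in
  \forall n \near \oo, expR (n%:R * (- tilt_exponent i vartheta x t - e)) <=
    W n vartheta G / Z n vartheta.
Proof.
move=> oG Gt t01 e0 x; have /andP[t0 t1] := t01.
have [x0 xt] := mu_invP i t01; rewrite -/x in x0 xt.
have /nbhs_ballP[d /= d0 dG] : nbhs t G by exact: open_nbhs_nbhs.
pose q := `|ln x - ln vartheta|; have q0 : 0 <= q by exact: normr_ge0.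
(* The radius keeps [t - f] and [t + f] inside (0, 1) and the ball inside [G], and bounds the
   variation of the tilt by [e / 2]; the other [e / 2] goes to the ratio of normalisations. *)
pose f := Num.min (Num.min (t / 2) ((1 - t) / 2)) (Num.min d (e / (2 * (q + 1)))).
have eq0 : 0 < e / (2 * (q + 1)) by rewrite divr_gt0 // mulr_gt0 //; lra.
have f0 : 0 < f by rewrite !lt_min d0 eq0 !divr_gt0 // subr_gt0.
have : f <= f by [].
rewrite {2}/f !le_min => /andP[/andP[f1 f2] /andP[f3 f4]].
have fe : f * (q + 1) <= e / 2.
  rewrite -ler_pdivlMr; last by lra.
  by have -> : e / 2 / (q + 1) = e / (2 * (q + 1)) by field; lra.
have te0 : 0 < t - f by lra.
have te1 : t + f < 1 by lra.
set B := [set s | t - f < s < t + f].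
have BG : B `<=` G.
  move=> s /= /andP[s1 s2]; apply: dG; rewrite /ball /= ltr_norml; apply/andP.
  by split; lra.
pose c := t * (ln x - ln vartheta) + e / 2.
have Bc s : B s -> s * (ln x - ln vartheta) <= c.
  move=> /= /andP[s1 s2]; rewrite /c.
  have : (s - t) * (ln x - ln vartheta) <= f * q.
    apply: le_trans (ler_norm _) _; rewrite normrM ler_wpM2r // ler_norml.
    by apply/andP; split; lra.
  by lra.
have ratio : \forall n \near \oo,
    expR (n%:R * (L x - L vartheta - e / 2)) <=
    expR (- ln 2) * (Z n x / Z n vartheta).
  by apply: stirling_ratio_gt => //; lra.
have conc := tilted_law_concentrates te0 te1 f0; rewrite -/x -/B /= in conc.
near=> n; have n0 : (0 < n)%N by near: n; exact: nbhs_infty_gt.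
have n0' : 0 < n%:R :> R by rewrite ltr0n.
have Z0 : 0 < Z n vartheta by rewrite stirling_poly_gt0 ?mulr_gt0.
have h1 : Z n x / 2 <= W n x B by near: n.
have h2 : expR (n%:R * (L x - L vartheta - e / 2)) <=
    expR (- ln 2) * (Z n x / Z n vartheta) by near: n.
have h3 := stirling_weight_tilt i n0 vartheta_gt0 x0 Bc.
have h4 := @stirling_weight_le R i n vartheta B G vartheta_gt0 BG.
have -> : - tilt_exponent i vartheta x t - e =
   (L x - L vartheta - e / 2) - c by rewrite /tilt_exponent /c; lra.
rewrite mulrBr expRB ler_pdivrMr ?expR_gt0 //; apply: le_trans h2 _.
have -> : expR (- ln 2) * (Z n x / Z n vartheta) = Z n x / 2 / Z n vartheta.
  by rewrite expRN lnK ?posrE //; ring.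
rewrite [leRHS]mulrAC ler_wpM2r ?invr_ge0 ?(ltW Z0) //.
apply: le_trans h1 _; apply: le_trans h3 _.
by rewrite mulrC ler_wpM2r ?expR_ge0.
Unshelve. all: by end_near. Qed.

(* The rate function is convex and vanishes at [mu i vartheta], so it does not
   increase when [t] moves towards that point; this reduces the lower bound at
   the endpoints of [0, 1] to interior points. *)
Lemma stirling_rate_towards_mean (t s : R) : 0 <= s <= 1 ->
  (rate (t + s * (mu i vartheta - t))%R <= rate t)%E.
Proof.
move=> /andP[s0 s1]; set m := mu i vartheta; apply: lee_lt_EFin => a.
move=> /lt_rate_tilt_exponent[x x0 ax].
have h0 := stirling_rate_ge0 i t vartheta_gt0.
have [a0|a0] := leP a 0; first by apply: le_trans h0; rewrite lee_fin.
apply: le_trans (tilt_exponent_le_rate i vartheta t x0); rewrite lee_fin.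
(* At the moved point the affine exponent is the mean of its values at [t] and [m] with weights
   [1 - s] and [s]. As the latter is at most 0 and [a > 0], the value at [t] is at least [a]. *)
have hm : tilt_exponent i vartheta x m <= 0.
  have := le_trans (tilt_exponent_le_rate i vartheta m x0) rate_at_mean.
  by rewrite lee_fin.
move: ax hm; rewrite /tilt_exponent.
set Lx := L x; set Lv := L vartheta; set lx := ln x; set lv := ln vartheta.
move=> ax hm.
have : (1 - s) * (t * lx - Lx - (t * lv - Lv)) +
    s * (m * lx - Lx - (m * lv - Lv)) > a by lra.
by nra.
Qed.

Lemma ldp_lower (t r e : R) (G : set R) : open G -> G t -> rate t = r%:E ->
  0 < e ->
  \forall n \near \oo,
    expR (n%:R * (- r - e)) <= W n vartheta G / Z n vartheta.
Proof.
move=> oG Gt tr e0; set m := mu i vartheta.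
have m0 : 0 < m by exact: mu_gt0.
have m1 : m < 1 by exact: mu_lt1.
have t01 : 0 <= t <= 1.
  move: tr; rewrite /stirling_rate; case: ifP => [/andP[? ?] _|_].
    by apply/andP; split; lra.
  by case: eqP => [-> _|_]; [|case: eqP => [-> _|//]]; rewrite ?lexx ler01.
have /nbhs_ballP[d /= d0 dG] : nbhs t G by exact: open_nbhs_nbhs.
(* With [s <= 1 / 2] the moved point is interior even if [t] is 0 or 1; with [s <= d / 2] it stays
   in the ball, since [m] and [t] are at distance at most 1. *)
pose s := Num.min (1 / 2) (d / 2).
have s0 : 0 < s by rewrite lt_min !divr_gt0.
have [s1 sd] : s <= 1 / 2 /\ s <= d / 2 by rewrite /s !ge_min !lexx orbT.
have s01 : 0 <= s <= 1 by apply/andP; split; lra.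
have := stirling_rate_towards_mean t s01; rewrite -/m tr.
set t' := t + s * (m - t) => ht'.
have /andP[t0 t1] := t01.
have t'01 : 0 < t' < 1 by rewrite /t'; apply/andP; split; nra.
have Gt' : G t'.
  apply: dG; rewrite /ball /= /t' opprD addrA subrr sub0r normrN normrM.
  rewrite ger0_norm ?(ltW s0) //.
  have : `|m - t| <= 1 by rewrite ler_norml; apply/andP; split; lra.
  by have := normr_ge0 (m - t); nra.
have := ldp_lower_interior oG Gt' t'01 e0.
move: ht'; rewrite /stirling_rate t'01 lee_fin -/(tilt_exponent _ _ _ _).
move=> ht' /=.
apply: filterS => n; apply: le_trans; rewrite ler_expR ler_wpM2l //; lra.
Qed.

End stirling_ldp.

Theorem corollary2p11 (R : realType) (vartheta : R) (vartheta_gt0 : 0 < vartheta)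
    (i : kind) (d : nat -> measure_display) (T : forall n, measurableType (d n))
    (P : forall n, probability (T n) R) (X : forall n, {RV (P n) >-> R})
    (hX : forall n, (0 < n)%N ->
       stirling_distributed i n (vartheta * n%:R) (X n)) :
  large_deviations_principle (fun n => n%:R) P (fun n w => X n w / n%:R)
    (stirling_rate i vartheta) /\
  forall t : R, 0 < t < 1 ->
    mu_inv i t =
      match i with
      | First => - (t / (t + lambertWm1 (- t * expR (- t))))
      | Second => t / (1 + t * lambertW0 (- t^-1 * expR (- t^-1))) - t
      end.
Proof.
split; last by move=> t t01; exact: mu_invE.
split.
- by move=> t; exact: stirling_rate_ge0.
- exact: stirling_rate_lsc.
- move=> F cF; rewrite leeNr; apply: lee_lt_EFin => a aF; rewrite leeNr.
  apply: limn_esup_le_near; have mF := measurable_realfun.closed_measurable cF.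
  (* For negative [a] it suffices that probabilities are at most 1. *)
  have [a0|/ltW a0] := leP 0 a; last first.
    near=> n; have n0 : (0 < n)%N by near: n; exact: nbhs_infty_gt.
    apply: (@le_trans _ _ 0%E); last by rewrite -EFinN lee_fin oppr_ge0.
    rewrite mule_ge0_le0 ?lee_fin ?invr_ge0 // lne_le0.
    apply: probability_le1; exact: measurable_scaled_preimage.
  have aF' t : F t -> (a%:E < stirling_rate i vartheta t)%E.
    by move=> Ft; apply: lt_le_trans aF _; apply: ereal_inf_lbound; exists t.
  have up := ldp_upper vartheta_gt0 cF a0 aF'.
  near=> n; have n0 : (0 < n)%N by near: n; exact: nbhs_infty_gt.
  have n0' : 0 < n%:R :> R by rewrite ltr0n.
  rewrite (prob_stirling n0 vartheta_gt0 (hX n n0) mF) -EFinN.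
  apply: scaled_lne_le => //; last by near: n.
  rewrite divr_ge0 ?stirling_weight_ge0 // ltW //.
  by rewrite stirling_poly_gt0 // mulr_gt0.
- move=> G oG; rewrite leeNl; apply: le_ereal_inf_tmp => _ [t Gt <-].
  rewrite leeNl; have mG := measurable_realfun.open_measurable oG.
  have := stirling_rate_ge0 i t vartheta_gt0.
  case tr : (stirling_rate i vartheta t) => [r| |] // _; last by rewrite leNye.
  rewrite -EFinN; apply: lee_lt_EFin => a; rewrite lte_fin => ar.
  have e0 : 0 < - r - a by lra.
  have low := ldp_lower vartheta_gt0 oG Gt tr e0.
  apply: limn_einf_ge_near.
  near=> n; have n0 : (0 < n)%N by near: n; exact: nbhs_infty_gt.
  rewrite (prob_stirling n0 vartheta_gt0 (hX n n0) mG).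
  apply: scaled_lne_ge => //.
  have -> : a = - r - (- r - a) by ring.
  by near: n.
Unshelve. all: by end_near. Qed.
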